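(* (a) For $n\ge1$ there is an isomorphism of extensions, equal to the identity on the sub $\Sigma^{-1}G(n)$ and on the quotient $G(2n-1)$, between $$0\to\Sigma^{-1}G(n)\xrightarrow{Sq^n\cdot}\Sigma^{-1}G(2n)\xrightarrow{p_{2n-1}}G(2n-1)\to0$$ (one desuspension of a Mahowald short exact sequence) and $$0\to\Sigma^{-1}G(n)\to Q(n,n-1)\to G(2n-1)\to0.$$ (b) For $n\ge0$ there is a pushout of extensions, i.e. a commutative diagram with exact rows whose left square is a pushout, from the top row $$0\to\Sigma^{-2}G(n+1)\xrightarrow{Sq^{n+1}\cdot}\Sigma^{-2}G(2n+2)\xrightarrow{p_{2n+1}}\Sigma^{-1}G(2n+1)\to0$$ (two desuspensions of a Mahowald short exact sequence) to the bottom row $$0\to\Sigma^{-1}G(n)\to Q(n,n)\to G(2n)\to0,$$ whose left vertical map is (the double desuspension of) $p_n$, and whose right vertical map $\Sigma^{-1}G(2n+1)\to G(2n)$ is an isomorphism. Thus the bottom sequence is isomorphic to the top one if $n$ is even.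
   Context: All vector spaces are over $\mathbb Z/2$ and $A$ is the mod 2 Steenrod algebra. $\mathcal M$ is the abelian category of locally finite graded right $A$-modules: Steenrod squares lower degree, $|xSq^i|=|x|-i$, and $x\cdot A$ is finite dimensional for every $x$. $\mathrm{Hom}_A$ and $\mathrm{Ext}_A$ are computed in $\mathcal M$; $(\Sigma^d M)_n=M_{n-d}$, with $\sigma^dx$ the shift of $x$, and $\mathrm{Ext}_A^{s,t}(N,M)=\mathrm{Ext}^s_{\mathcal M}(N,\Sigma^{-t}M)$. $M\in\mathcal M$ is unstable if $xSq^i=0$ whenever $2i>|x|$. $G(n)$ is the free unstable right $A$-module on a class $\iota_n$ of degree $n$: $\mathrm{Hom}_A(G(n),M)\cong M_n$, $f\mapsto f(\iota_n)$, for unstable $M$. For $a\in A^k$, $a\cdot:G(n)\to G(n+k)$ is the $A$-module map $\iota_n\mapsto\iota_{n+k}a$. $p_m:G(m+1)\to\Sigma G(m)$ is the nonzero $A$-module map, $\iota_{m+1}\mapsto\sigma\iota_m$; desuspensions of these maps are denoted by the same symbols. The Mahowald short exact sequences are $0\to G(n)\xrightarrow{Sq^n\cdot}G(2n)\xrightarrow{p_{2n-1}}\Sigma G(2n-1)\to0$, and each $p_{2n}:G(2n+1)\to\Sigma G(2n)$ is an isomorphism. Dyer-Lashof operations on Ext. For $N\in\mathcal M$, $\mathcal R_s(N)$ is spanned by symbols $Q^{I}x=Q^{i_1}\cdots Q^{i_s}x$ ($i_j\in\mathbb Z$, $x\in N$), linear in $x$, of degree $|x|+\sum i_j$, modulo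 $Q^r y=0$ for $r<|y|$ and $Q^rQ^u=\sum_i\binom{i-u-1}{2i-r}Q^{r+u-i}Q^i$ for $r>2u$; its right $A$-action is given by the Nishida relations $(Q^r y)Sq^k=\sum_i\binom{r-k}{k-2i}Q^{r-k+i}(ySq^i)$ (for $a<0$, $\binom ab$ is the coefficient of $x^b$ in $(1+x)^a$). There are natural well-defined $A$-module maps $d_s:\mathcal R_s(\Sigma^{-1}M)\to\mathcal R_{s+1}(M)$, $d_s(Q^I\sigma^{-1}x)=\sum_{i\ge0}Q^IQ^{i-1}(xSq^i)$, commuting with the $Q^r$ and with $d_sd_{s-1}=0$. Let $F_s(M)$ be the homology at the middle of $\mathcal R_{s-1}(\Sigma^{-2}M)\to\mathcal R_s(\Sigma^{-1}M)\to\mathcal R_{s+1}(M)$. It is known that $F_s(M)_{n-1}\cong\mathrm{Ext}_A^{s,s}(G(n),M)$ naturally, this being the unique isomorphism of $\delta$-functors (in $N=\Sigma^{-s}M$) extending the evident identification of $\ker d_0$ with the maximal unstable submodule for $s=0$. The operations $Q^r$ on $\mathcal R_*(\Sigma^{-1}M)$ induce $Q^r:\mathrm{Ext}_A^{s,s}(G(n),M)\to\mathrm{Ext}_A^{s+1,s+1}(G(n+r),M)$. For $n,r\ge0$, $0\to\Sigma^{-1}G(n)\to Q(n,r)\to G(n+r)\to0$ denotes the extension representing $Q^r(1_{G(n)})\in\mathrm{Ext}_A^{1,1}(G(n+r),G(n))$. *)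

(* Defs.v *)
From HB Require Import structures.
From mathcomp Require Import all_boot all_order all_algebra.
From mathcomp Require Import boolp classical_sets cardinality fsbigop.
From mathcomp.multinomials Require Import freeg.

Set Implicit Arguments.
Unset Strict Implicit.
Unset Printing Implicit Defensive.

Import Order.TTheory GRing.Theory Num.Theory.
Local Open Scope ring_scope.
Local Open Scope quotient_scope.

(* A graded vector space is encoded by its total space together with the
   projections [pr n] onto the homogeneous components, so that suspensions do
   not change the underlying space. The right action of the Steenrod algebra
   is given by the action of its generators [Sq i] (written on the left of
   their argument: [Sq i x] is x.Sq^i), subject to the Adem relations
   Sq^a Sq^b = \sum_j C(b-j-1, a-2j) Sq^(a+b-j) Sq^j for 0 < a < 2b.
   [Sq_word w x] is x.Sq^w1...Sq^wk: these elements span x.A, so that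
   [lfinite] says that x.A lies in the span of a finite list. *)
Definition Sq_word (V : Type) (Sq : nat -> V -> V) (w : seq nat) (x : V) : V :=
  foldl (fun y i => Sq i y) x w.

Record stmod := Stmod {
  car :> lmodType 'F_2;
  pr : int -> {linear car -> car};
  Sq : nat -> {linear car -> car};
  pr_pr : forall m n x, pr m (pr n x) = if m == n then pr n x else 0;
  pr_sum : forall x, exists2 t : seq int, uniq t & x = \sum_(n <- t) pr n x;
  Sq_pr : forall i n x, Sq i (pr n x) = pr (n - i%:Z) (Sq i x);
  Sq_0 : forall x, Sq 0 x = x;
  Sq_Adem : forall a b x, (0 < a)%N -> (a < b.*2)%N ->
    Sq b (Sq a x) =
    \sum_(j < a./2.+1)
      'C(b - j - 1, a - j.*2)%:R *: Sq j (Sq (a + b - j) x);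
  lfinite : forall x, exists b : seq car, forall w, exists c : nat -> 'F_2,
    Sq_word Sq w x = \sum_(i < size b) c i *: b`_i
}.

Arguments pr {s} n.
Arguments Sq {s} i.

Definition homog (M : stmod) (n : int) (x : M) : Prop := pr n x = x.

Record stHom (M N : stmod) := StHom {
  hom_fun :> {linear M -> N};
  hom_pr : forall n x, hom_fun (pr n x) = pr n (hom_fun x);
  hom_Sq : forall i x, hom_fun (Sq i x) = Sq i (hom_fun x)
}.

Definition hom_id (M : stmod) : stHom M M :=
  @StHom M M (idfun : {linear M -> M}) (fun _ _ => erefl) (fun _ _ => erefl).

(* [susp d M] is the suspension \Sigma^d M; x : M, viewed in [susp d M], is
   \sigma^d x. *)
Section Susp.
Variables (d : int) (M : stmod).
Let spr (n : int) : {linear M -> M} := pr (n - d).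

Let spr_spr m n (x : M) : spr m (spr n x) = if m == n then spr n x else 0.
Proof. by rewrite pr_pr (inj_eq (addIr _)). Qed.

Let spr_sum (x : M) : exists2 t : seq int, uniq t & x = \sum_(n <- t) spr n x.
Proof.
have [t ut xE] := pr_sum x; exists [seq n + d | n <- t].
  by rewrite map_inj_uniq //; apply: addIr.
by rewrite big_map {1}xE; apply: eq_bigr => n _; rewrite /spr addrK.
Qed.

Let Sq_spr i n (x : M) : Sq i (spr n x) = spr (n - i%:Z) (Sq i x).
Proof. by rewrite Sq_pr addrAC. Qed.

Definition susp : stmod :=
  Stmod spr_spr spr_sum Sq_spr (@Sq_0 M) (@Sq_Adem M) (@lfinite M).
End Susp.

Definition susp_hom (d : int) (M N : stmod) (f : stHom M N) :
    stHom (susp d M) (susp d N) :=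
  @StHom (susp d M) (susp d N) f (fun n x => hom_pr f (n - d) x) (hom_Sq f).

Notation desusp := (susp (-1)).
Notation desusp_hom := (susp_hom (-1)).

(* The desuspension of a map M -> \Sigma N, as a map \Sigma^-1 M -> N. *)
Section DesuspSusp.
Variables (M N : stmod) (f : stHom M (susp 1 N)).
Let dspr n (x : desusp M) : (f : {linear M -> N}) (pr n x) = pr n (f x : N).
Proof. by rewrite [LHS](hom_pr f) /= opprK addrK. Qed.

Definition desusp_susp_hom : stHom (desusp M) N :=
  @StHom (desusp M) N f dspr (hom_Sq f).
End DesuspSusp.

Definition short_exact (A B C : stmod) (f : stHom A B) (g : stHom B C) : Prop :=
  [/\ injective f, forall y, g y = 0 <-> exists x, f x = y
    & forall z, exists y, g y = z].

Definition seq_iso (A B C A' B' C' : stmod) (f : stHom A B) (g : stHom B C)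
    (f' : stHom A' B') (g' : stHom B' C') : Prop :=
  exists (a : stHom A A') (b : stHom B B') (c : stHom C C'),
    [/\ bijective a, bijective b, bijective c,
        forall x, b (f x) = f' (a x) & forall y, c (g y) = g' (b y)].

Record extension (A C : stmod) := Extension {
  ext_mid :> stmod;
  ext_in : stHom A ext_mid;
  ext_out : stHom ext_mid C;
  ext_exact : short_exact ext_in ext_out
}.

(* Isomorphism of extensions, the identity on the sub and on the quotient *)
Definition ext_iso (A C : stmod) (E E' : extension A C) : Prop :=
  exists t : stHom E E', [/\ bijective t,
    forall x, t (ext_in E x) = ext_in E' x &
    forall y, ext_out E' (t y) = ext_out E y].

Definition is_pushout (A B C D : stmod) (f : stHom A B) (g : stHom A C)
    (h : stHom B D) (k : stHom C D) : Prop :=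
  (forall x, h (f x) = k (g x)) /\
  forall (X : stmod) (u : stHom B X) (v : stHom C X),
    (forall x, u (f x) = v (g x)) ->
    exists w : stHom D X,
      [/\ forall y, w (h y) = u y, forall y, w (k y) = v y
        & forall w' : stHom D X, (forall y, w' (h y) = u y) ->
            (forall y, w' (k y) = v y) -> forall z, w' z = w z].

Definition unstable (M : stmod) : Prop :=
  forall (n : int) (i : nat) (x : M),
    homog n x -> n < (i.*2)%:Z -> Sq i x = 0.

Record free_unstable (n : nat) := FreeUnstable {
  fu_mod :> stmod;
  iota_ : fu_mod;
  fu_unstable : unstable fu_mod;
  iota_homog : homog n%:Z iota_;
  fu_univ : forall M : stmod, unstable M -> forall x : M, homog n%:Z x ->
    exists2 f : stHom fu_mod M, f iota_ = x
      & forall g : stHom fu_mod M, g iota_ = x -> forall y, g y = f y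
}.

Arguments iota_ {n} f.
Arguments iota_homog {n} f.
Arguments fu_unstable {n} f.

Section FreeMap.
Variables (n : nat) (G : free_unstable n) (M : stmod) (uM : unstable M).
Variables (x : M) (xn : homog n%:Z x).

Let ex_free_map : exists f : stHom G M, f (iota_ G) = x.
Proof. by have [f fE _] := fu_univ G uM xn; exists f. Qed.

Definition free_map : stHom G M := projT1 (cid ex_free_map).

Lemma free_map_iota : free_map (iota_ G) = x.
Proof. exact: projT2 (cid ex_free_map). Qed.
End FreeMap.

Section FreeUnstableMaps.
Variable G : forall n, free_unstable n.

Lemma iota_Sq_homog k n m : m = (n + k)%N -> homog n%:Z (Sq k (iota_ (G m))).
Proof.
move=> mE; rewrite /homog -{2}(iota_homog (G m)) Sq_pr mE.
by rewrite PoszD addrK.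
Qed.

(* Sq^k. : G(n) -> G(m), for m = n + k *)
Definition Sq_dot k n m (mE : m = (n + k)%N) : stHom (G n) (G m) :=
  free_map (G n) (fu_unstable (G m)) (iota_Sq_homog mE).

Lemma susp1_unstable M : unstable M -> unstable (susp 1 M).
Proof.
move=> uM n i x xn ni; apply: uM xn _.
by apply: le_lt_trans ni; rewrite lerBlDr lerDl.
Qed.

Lemma sigma_iota_homog m : @homog (susp 1 (G m)) m.+1%:Z (iota_ (G m)).
Proof. by rewrite /homog /= intS addrC addKr; apply: iota_homog. Qed.

Definition p_ m : stHom (G m.+1) (susp 1 (G m)) :=
  free_map (G m.+1) (susp1_unstable (fu_unstable (G m))) (sigma_iota_homog m).
End FreeUnstableMaps.

(* [symrel N s z] says that the formal sum z of symbols (I, x), read Q^I x, is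
   one of the relations defining R_s(N). Symbols of length other than s are
   killed, so that only Q^I x with I of length s survives. In the Adem relation
   i = u + 1 + k: the terms with i <= u vanish because 2i < r, and those with
   k >= r - 2u because the binomial coefficient is 0. *)
Notation symbols N := {freeg (seq int * car N)%type / 'F_2}.
Notation symbol I x := (<< (I, x) >> : symbols _).

Definition sumz (I : seq int) : int := \sum_(i <- I) i.

Variant symrel (N : stmod) (s : nat) : symbols N -> Prop :=
| Sym_size (I : seq int) (x : N) of size I != s : symrel s (symbol I x)
| Sym_linear (I : seq int) (x y : N) :
    symrel s (symbol I (x + y) - symbol I x - symbol I y)
| Sym_unstable (J : seq int) (r : int) (I : seq int) (n : int) (x : N)
    of homog n x & r < n + sumz I : symrel s (symbol (J ++ r :: I) x)
| Sym_Adem (J : seq int) (r u : int) (I : seq int) (x : N) of 2 * u < r :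
    symrel s (symbol (J ++ r :: u :: I) x -
      \sum_(k < absz (r - 2 * u)%R)
         let i := u + 1 + k%:Z in
         (if r <= 2 * i then 'C(k, absz (2 * i - r)%R)%:R else 0) *:
         symbol (J ++ (r + u - i) :: i :: I) x).

(* The subspace spanned by the relations; over 'F_2 it is enough to take sums. *)
Definition symspan (N : stmod) (s : nat) : {pred symbols N} :=
  fun z => `[< exists2 t : seq (symbols N),
     (forall w, w \in t -> symrel s w) & z = \sum_(w <- t) w >].

Lemma addff2 (V : lmodType 'F_2) (x : V) : x + x = 0.
Proof.
rewrite -[x + x]/(x *+ 2) -scaler_nat.
suff -> : 2%:R = 0 :> 'F_2 by rewrite scale0r.
exact/val_inj.
Qed.

Lemma oppf2 (V : lmodType 'F_2) (x : V) : - x = x.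
Proof. by apply/eqP; rewrite eq_sym -subr_eq0 opprK addff2. Qed.

Lemma scalef2 (V : lmodType 'F_2) (a : 'F_2) (x : V) :
  a *: x = if a == 0 then 0 else x.
Proof.
case: eqP => [->|/eqP a0]; first exact: scale0r.
suff -> : a = 1 by rewrite scale1r.
by case: a a0 => [[|[|m]] //= mlt] a0; apply/val_inj.
Qed.

Section SymSpan.
Variables (N : stmod) (s : nat).

Fact symspan_submod : submod_closed (@symspan N s).
Proof.
split=> [|a x y /asboolP[t ht ->] /asboolP[t' ht' ->]].
  by apply/asboolP; exists [::]; rewrite ?big_nil.
apply/asboolP; rewrite scalef2; case: (a == 0).
  by exists t'; rewrite ?add0r.
exists (t ++ t'); last by rewrite big_cat.
by move=> w; rewrite mem_cat => /orP[/ht|/ht'].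
Qed.

HB.instance Definition _ :=
  GRing.isSubmodClosed.Build 'F_2 (symbols N) (@symspan N s) symspan_submod.
End SymSpan.

Definition Rs (s : nat) (N : stmod) : Type := Quotient.quot (@symspan N s).

Section RsModule.
Variables (s : nat) (N : stmod).

HB.instance Definition _ := EqQuotient.on (Rs s N).
HB.instance Definition _ := GRing.Zmodule.on (Rs s N).

Definition cls (z : symbols N) : Rs s N := \pi_(Rs s N) z.

Lemma cls_eq x y : (cls x == cls y) = (x - y \in @symspan N s).
Proof. by rewrite Quotient.idealrBE. Qed.

Lemma clsD : {morph cls : x y / x + y}.
Proof. by move=> x y; rewrite /cls [LHS](Quotient.pi_add (@symspan N s)). Qed.

Lemma cls_repr z : cls (repr z) = z.
Proof. exact: reprK. Qed.

Definition Rs_scale (a : 'F_2) (z : Rs s N) : Rs s N := cls (a *: repr z).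

Lemma cls_scale a z : cls (a *: z) = Rs_scale a (cls z).
Proof.
apply/eqP; rewrite cls_eq -scalerBr rpredZ // -cls_eq.
by rewrite cls_repr.
Qed.

Fact Rs_scaleA a b z : Rs_scale a (Rs_scale b z) = Rs_scale (a * b) z.
Proof. by rewrite -[z]cls_repr -!cls_scale scalerA. Qed.

Fact Rs_scale1 : left_id 1 Rs_scale.
Proof. by move=> z; rewrite -[z]cls_repr -cls_scale scale1r. Qed.

Fact Rs_scaleDr : right_distributive Rs_scale +%R.
Proof.
move=> a x y; rewrite -[x]cls_repr -[y]cls_repr -clsD -!cls_scale -clsD.
by rewrite scalerDr.
Qed.

Fact Rs_scaleDl z : {morph Rs_scale^~ z : a b / a + b}.
Proof.
by move=> a b; rewrite -[z]cls_repr -!cls_scale -clsD scalerDl.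
Qed.

HB.instance Definition _ := GRing.Zmodule_isLmodule.Build 'F_2 (Rs s N)
  Rs_scaleA Rs_scale1 Rs_scaleDr Rs_scaleDl.

Fact cls_linear : linear cls.
Proof. by move=> a x y; rewrite clsD cls_scale. Qed.

HB.instance Definition _ :=
  GRing.isLinear.Build 'F_2 (symbols N) (Rs s N) _ cls cls_linear.

Definition Qsym (I : seq int) (x : N) : Rs s N := cls (symbol I x).

End RsModule.

Arguments Qsym s {N} I x.

Section FglidLinear.
Variables (K : choiceType) (V : lmodType 'F_2) (g : K -> V).

Fact fglift_linear : linear (fglift g : {freeg K / 'F_2} -> V).
Proof.
have fgB : {morph fglift g : x y / x - y} := lift_is_additive g.
move=> a x y; rewrite -[y in LHS]opprK fgB -[- y]sub0r fgB !scalef2.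
have -> : fglift g 0 = 0 by rewrite -(subrr 0) fgB subrr.
by rewrite sub0r opprK; case: (a == 0); rewrite // -(subrr 0) fgB subrr.
Qed.

HB.instance Definition _ :=
  GRing.isLinear.Build 'F_2 {freeg K / 'F_2} V _ (fglift g) fglift_linear.
End FglidLinear.

Record respects (s : nat) (N : stmod) (V : lmodType 'F_2)
    (g : seq int -> N -> V) : Prop := Respects {
  resp_size : forall I x, size I != s -> g I x = 0;
  resp_linear : forall I x y, g I (x + y) = g I x + g I y;
  resp_unstable : forall J r I n x, homog n x -> r < n + sumz I ->
    g (J ++ r :: I) x = 0;
  resp_Adem : forall J r u I x, 2 * u < r ->
    g (J ++ r :: u :: I) x =
    \sum_(k < absz (r - 2 * u)%R)
       let i := u + 1 + k%:Z in
       (if r <= 2 * i then 'C(k, absz (2 * i - r)%R)%:R else 0) *: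
       g (J ++ (r + u - i) :: i :: I) x
}.

Lemma Qsym_respects s N : respects s (@Qsym s N).
Proof.
have rel0 w : symrel s w -> cls s w = 0 :> Rs s N.
  move=> hw; rewrite -[0](linear0 (@cls s N)); apply/eqP; rewrite cls_eq subr0.
  by apply/asboolP; exists [:: w]; rewrite ?big_seq1 // => v /[!inE] /eqP ->.
split=> [I x hI|I x y|J r I n x xn ri|J r u I x ru].
- exact/rel0/Sym_size.
- apply/eqP; rewrite -subr_eq0 opprD addrA -!linearB.
  exact/eqP/rel0/Sym_linear.
- exact/rel0/(Sym_unstable s J xn ri).
- apply/eqP; rewrite -subr_eq0; apply/eqP.
  under eq_bigr do rewrite /= -linearZ.
  rewrite -linear_sum -linearB; exact/rel0/(Sym_Adem s J I x ru).
Qed.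

Section Rlift.
Variables (s : nat) (N : stmod) (V : lmodType 'F_2) (g : seq int -> N -> V).
Hypothesis gP : respects s g.

Definition Rlift_fun (z : Rs s N) : V := fglift (fun u => g u.1 u.2) (repr z).

Fact Rlift_cls z : Rlift_fun (cls s z) = fglift (fun u => g u.1 u.2) z.
Proof.
apply/eqP; rewrite -subr_eq0 -raddfB /=.
have: repr (cls s z) - z \in @symspan N s by rewrite -cls_eq cls_repr.
case/asboolP=> t ht ->; rewrite raddf_sum big_seq big1 //= => w /ht {t ht}.
case=> [I x hI|I x y|J r I n x xn ri|J r u I x ru]; rewrite ?linearB /=.
- by rewrite liftU scale1r (resp_size gP).
- by rewrite !liftU !scale1r (resp_linear gP) addrAC addrK subrr.
- by rewrite liftU scale1r (resp_unstable gP J xn).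
- rewrite liftU scale1r (resp_Adem gP) // linear_sum; apply/eqP.
  rewrite subr_eq0; apply/eqP/eq_bigr => k _ /=.
  by rewrite linearZ /= liftU scale1r.
Qed.

Fact Rlift_linear : linear Rlift_fun.
Proof.
move=> a x y; rewrite -[x]cls_repr -[y]cls_repr -linearP !Rlift_cls.
by rewrite linearP.
Qed.

HB.instance Definition _ :=
  GRing.isLinear.Build 'F_2 (Rs s N) V _ Rlift_fun Rlift_linear.

Definition Rlift : {linear Rs s N -> V} := Rlift_fun.

Lemma Rlift_sym I x : Rlift (Qsym s I x) = g I x.
Proof. by rewrite /= Rlift_cls liftU scale1r. Qed.
End Rlift.

Section Qop.
Variables (s : nat) (N : stmod) (r : int).

Fact Qop_respects : respects s (fun I (x : N) => Qsym s.+1 (r :: I) x).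
Proof.
have R := Qsym_respects s.+1 N.
split=> [I x hI|I x y|J q I n x xn qi|J q u I x qu].
- exact: (resp_size R).
- exact: (resp_linear R).
- exact: (resp_unstable R (r :: J) xn qi).
- exact: (resp_Adem R (r :: J) I x qu).
Qed.

Definition Qop : {linear Rs s N -> Rs s.+1 N} := Rlift Qop_respects.
End Qop.

Section Rmap.
Variables (s : nat) (N N' : stmod) (f : stHom N N').

Lemma hom_homog n x : homog n x -> homog n (f x).
Proof. by rewrite /homog -hom_pr => ->. Qed.

Fact Rmap_respects : respects s (fun I (x : N) => Qsym s I (f x)).
Proof.
have R := Qsym_respects s N'.
split=> [I x hI|I x y|J q I n x xn qi|J q u I x qu].
- exact: (resp_size R).
- by rewrite linearD; apply: (resp_linear R).
- exact: (resp_unstable R J (hom_homog xn) qi).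
- exact: (resp_Adem R J I _ qu).
Qed.

Definition Rmap : {linear Rs s N -> Rs s N'} := Rlift Rmap_respects.
End Rmap.

(* d_s : R_s(\Sigma^-1 M) -> R_{s+1}(M),
   Q^I \sigma^-1 x |-> \sum_i Q^I Q^(i-1) (x Sq^i) *)
Section Differential.
Variables (s : nat) (M : stmod).
Local Open Scope classical_set_scope.

Definition d_sym (I : seq int) (x : M) : Rs s.+1 M :=
  \sum_(i \in [set: nat]) Qsym s.+1 (rcons I (i%:Z - 1)) (Sq i x).

Lemma homog_Sq n i (x : M) : homog n x -> homog (n - i%:Z) (Sq i x).
Proof. by move=> xn; rewrite /homog -Sq_pr xn. Qed.

Lemma pr_homog n (x : M) : homog n (pr n x).
Proof. by rewrite /homog pr_pr eqxx. Qed.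

Lemma Sq_finite (x : M) : exists B, forall i, (B <= i)%N -> Sq i x = 0.
Proof.
have pr_fin (y : M) : exists B : nat, forall n : int, n < - B%:Z -> pr n y = 0.
  have [t _ ->] := pr_sum y; exists (\max_(n <- t) absz n)%N => n nB.
  rewrite linear_sum big_seq big1 //= => m mt; rewrite pr_pr; case: eqP => // nm.
  have := @leq_bigmax_seq _ t xpredT absz m mt isT; rewrite -lez_nat -nm abszE => Bn.
  have := ler_norm (- n); rewrite normrN => /le_trans/(_ Bn).
  by rewrite lerNl leNgt nB.
have fin_homog n (y : M) : homog n y ->
    exists B, forall i, (B <= i)%N -> Sq i y = 0.
  move=> yn; have [b hb] := lfinite y.
  have [B hB] : exists B : nat, forall n : int, n < - B%:Z ->
      forall i : 'I_(size b), pr n b`_i = 0.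
    have [h hh] := choice (fun i : 'I_(size b) => pr_fin b`_i).
    exists (\max_i h i)%N => m mB i; apply: hh; apply: lt_le_trans mB _.
    by rewrite lerN2 lez_nat; apply: leq_bigmax.
  exists (B + absz n).+1 => i hi; have [c /= hc] := hb [:: i].
  have ilt : n - i%:Z < - B%:Z.
    rewrite ltrBlDr addrC ltrBrDr (le_lt_trans (y := (B + absz n)%:Z)) //.
    by rewrite PoszD addrC lerD2l abszE ler_norm.
  rewrite -(homog_Sq i yn) hc linear_sum big1 //= => j _.
  by rewrite linearZ /= (hB _ ilt) scaler0.
have [t _ xE] := pr_sum x.
have [h hh] := choice (fun n => fin_homog n _ (pr_homog n x)).
exists (\max_(n <- t) h n)%N => i hi.
rewrite xE linear_sum big_seq big1 //= => n nt; apply: hh.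
by apply: leq_trans hi; apply: (@leq_bigmax_seq _ t xpredT h n nt isT).
Qed.

Lemma d_symE (I : seq int) (x : M) B : (forall i, (B <= i)%N -> Sq i x = 0) ->
  d_sym I x = \sum_(i < B) Qsym s.+1 (rcons I (i%:Z - 1)) (Sq i x).
Proof.
move=> hB; rewrite /d_sym (fsbig_ord _ _ (fun i => Qsym s.+1 (rcons I (i%:Z - 1)) (Sq i x))).
apply/esym/fsbig_widen => //.
move=> i /= [_ /negP]; rewrite -leqNgt => /hB ->.
apply: (addIr (Qsym s.+1 (rcons I (i%:Z - 1)) (0 : M))).
by rewrite -(resp_linear (Qsym_respects _ _)) !add0r.
Qed.

Fact d_respects : respects s (fun I (x : desusp M) => d_sym I x).
Proof.
have R := Qsym_respects s.+1 M.
split=> [I x hI|I x y|J r I n x xn ri|J r u I x ru].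
- rewrite /d_sym fsbig1 // => i _.
  by apply: (resp_size R); rewrite size_rcons.
- have [B hB] := Sq_finite x; have [C hC] := Sq_finite y.
  have hx i : (maxn B C <= i)%N -> Sq i (x : M) = 0.
    by rewrite geq_max => /andP[/hB].
  have hy i : (maxn B C <= i)%N -> Sq i (y : M) = 0.
    by rewrite geq_max => /andP[_ /hC].
  rewrite (d_symE I hx) (d_symE I hy) (@d_symE I _ (maxn B C)); last first.
    by move=> i hi; rewrite linearD /= (hx i hi) (hy i hi) addr0.
  rewrite -big_split; apply: eq_bigr => i _ /=.
  by rewrite linearD /= (resp_linear R).
- rewrite /d_sym fsbig1 // => i _; rewrite rcons_cat rcons_cons.
  apply: (resp_unstable R J (homog_Sq i xn)).
  rewrite /sumz big_rcons /=.
  have -> : n - -1 - i%:Z + (\sum_(k <- I) k + (i%:Z - 1)) = n + \sum_(k <- I) k.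
    by rewrite opprK addrACA addKr addrAC addrK.
  by [].
- have [B hB] := Sq_finite x; rewrite !(d_symE _ hB).
  under eq_bigr do rewrite rcons_cat !rcons_cons (resp_Adem R _ _ _ ru).
  rewrite exchange_big /=; apply: eq_bigr => k _.
  rewrite (d_symE _ hB) scaler_sumr; apply: eq_bigr => i _.
  by rewrite rcons_cat !rcons_cons.
Qed.

Definition d_ : {linear Rs s (desusp M) -> Rs s.+1 M} := Rlift d_respects.
End Differential.

Lemma d_Qsym s (M : stmod) I (x : M) :
  d_ s M (Qsym s I (x : desusp M)) = d_sym s I x.
Proof. exact: Rlift_sym. Qed.

(* z lies in the component of degree k of R_s(N). *)
Definition Rs_homog s (N : stmod) (k : int) (z : Rs s N) : Prop :=
  exists2 t : seq (seq int * N),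
    (forall u, u \in t -> homog (k - sumz u.1) u.2)
    & z = \sum_(u <- t) Qsym s u.1 u.2.

(* F_s(M)_k is the space of cycles [Fcycle] modulo the boundaries [Fbound];
   [Feq] says that two cycles have the same class in F_s(M)_k. *)
Definition Fcycle s (M : stmod) (k : int) (z : Rs s (desusp M)) : Prop :=
  Rs_homog k z /\ d_ s M z = 0.

Definition Fbound s (M : stmod) (k : int) : Rs s (desusp M) -> Prop :=
  match s with
  | 0 => fun z => z = 0
  | s'.+1 => fun z =>
      exists2 y : Rs s' (desusp (desusp M)), Rs_homog k y & z = d_ s' (desusp M) y
  end.

Definition Feq s (M : stmod) (k : int) (z z' : Rs s (desusp M)) : Prop :=
  [/\ Fcycle k z, Fcycle k z' & Fbound k (z - z')].

(* The connecting homomorphism of the \delta-functor F: for an exact sequence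
   0 -> N' -> N -> N'' -> 0, the cycle z of R_{s+1}(N') represents, in degree k,
   the image of the class of the cycle c of R_s(\Sigma^-1 N''). *)
Definition connecting s (N' N'' : stmod) (S : extension N' N'') (k : int)
    (c : Rs s (desusp N'')) (z : Rs s.+1 N') : Prop :=
  Rs_homog k z /\
  exists e : Rs s (desusp S),
    [/\ Rs_homog k e, Rmap s (desusp_hom (ext_out S)) e = c
      & d_ s S e = Rmap s.+1 (ext_in S) z].

Section ExtClasses.
Variable G : forall n, free_unstable n.

(* Hom(G(n), M) = F_0(M)_{n-1}: f corresponds to \sigma^-1 f(iota_n). *)
Definition hom_class n (M : stmod) (f : stHom (G n) M) : Rs 0 (desusp M) :=
  Qsym 0 [::] (f (iota_ (G n)) : desusp M).

(* The class of E in Ext^1(G(m), N) is the image of 1 in Hom(G(m), G(m)) under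
   the connecting homomorphism of E. So the isomorphism of \delta-functors
   extending [hom_class] sends it to the image of [hom_class 1] under the
   connecting homomorphism of F, cf. [ext_class_unique]. *)
Definition ext_class m (N : stmod) (E : extension N (G m)) (z : Rs 1 N) : Prop :=
  connecting E (m%:Z - 1) (hom_class (hom_id (G m))) z.

(* Let Phi send (the class of) each extension of G(m) to a set of cycles. If it
   commutes with all connecting homomorphisms, then it agrees with [ext_class].
   The image of f : G(m) -> N'' under Hom(G(m), N'') -> Ext^1(G(m), N') is the
   class of any extension E of G(m) that maps to S over f and under N'. *)
Lemma ext_class_unique m
    (Phi : forall N, extension N (G m) -> Rs 1 N -> Prop) :
  (forall (N' N'' : stmod) (S : extension N' N'') (f : stHom (G m) N'')
      (E : extension N' (G m)) (g : stHom E S),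
    (forall x, g (ext_in E x) = ext_in S x) ->
    (forall y, ext_out S (g y) = f (ext_out E y)) ->
    forall z, Phi N' E z <-> connecting S (m%:Z - 1) (hom_class f) z) ->
  forall N (E : extension N (G m)) z, Phi N E z <-> ext_class E z.
Proof. by move=> PhiP N E; apply: (PhiP N _ E _ E (hom_id E)). Qed.

(* The extension 0 -> \Sigma^-1 M -> E -> G(m) -> 0, where m = n + r, represents
   Q^r f in Ext^{1,1}(G(n+r), M), for f in Ext^{0,0}(G(n), M) = Hom(G(n), M). *)
Definition represents_Q (r : int) n m (M : stmod) (f : stHom (G n) M)
    (E : extension (desusp M) (G m)) : Prop :=
  m%:Z = n%:Z + r /\
  exists2 z, ext_class E z & Feq (m%:Z - 1) z (Qop 0 _ r (hom_class f)).

(* E is the extension Q(n, r), whose quotient is G(m), m = n + r *)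
Definition is_Q_ext (n r m : nat) (E : extension (desusp (G n)) (G m)) : Prop :=
  represents_Q r%:Z (hom_id (G n)) E.
End ExtClasses.

(* Main.v *)
Require Import Defs.
From HB Require Import structures.
From mathcomp Require Import all_boot all_order all_algebra.
From mathcomp Require Import boolp zify ring.
From mathcomp.multinomials Require mpoly.

Set Implicit Arguments.
Unset Strict Implicit.
Unset Printing Implicit Defensive.

Import Order.TTheory GRing.Theory Num.Theory.
Local Open Scope ring_scope.
Local Open Scope quotient_scope.

(* Put J = F_2[x_0, x_1, ...], with x_i in degree 1, and let the total square act
   by the ring homomorphism x_i |-> x_i + x_{i-1}^2, where x_{-1} = 0. The dual of J
   is an unstable right A-module: the Adem relations follow from the identity
   P(s^2 + s) P(1) = P(1 + s) P(s^2), where P(v) is the homomorphism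
   x_i |-> x_i + v x_{i-1}^2, by taking residues. If iota_n denotes the class dual
   to x_0^n, then the dual of multiplication by x_0 sends iota_{n+1} to iota_n, and
   the dual of the shift x_{i+1} |-> x_i, x_0 |-> 0 is injective and sends iota_n to
   iota_{2n}.Sq^n. Comparing G(n) with the dual of J gives, by induction on n, the
   injectivity of Sq^n. : G(n) -> G(2n). The rest of the Mahowald sequence is
   formal: in an unstable module, (x Sq^(2i)) Sq_0 = (x Sq_0) Sq^i and
   (x Sq^(2i+1)) Sq_0 = 0 for Sq_0 x = x Sq^(|x|/2), so G(2n) / (iota_{2n}.Sq^n A)
   is the suspension of an unstable module.

   Reading off the coefficients of the cycle condition in R_1 shows that Q(n, r)
   contains a class e over iota_{n+r} with e.Sq^(r+1) the image of iota_n, and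
   e.Sq^i = 0 for the other i with 2i > n + r. So the first (r = n - 1) or second
   (r = n) suspension of Q(n, r) is unstable, and e defines a map to it from G(2n)
   or G(2n+2), to which the five lemma applies. *)

(** * The dual of the polynomial algebra J *)

(* [mpoly] is imported only locally: its notations turn [homog] into a keyword. *)
Section PolynomialDual.
Import mpoly.

(** * The total square on polynomials in x_0, ..., x_k *)

Section TotalSquare.
Variable k : nat.

Section Substitution.
Variable B : comNzRingType.
Implicit Types (v w : B) (p : {mpoly B[k.+1]}).

(** The sum has at most one term, x_{i-1}^2, and is empty for i = 0; this encodes x_{-1} = 0. *)
Definition sqvar (i : 'I_k.+1) : {mpoly B[k.+1]} :=
  \sum_(j < k.+1 | j.+1 == i) 'X_j ^+ 2.

Definition tsq v : {mpoly B[k.+1]} -> {mpoly B[k.+1]} :=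
  comp_mpoly [tuple 'X_i + v *: sqvar i | i < k.+1].

HB.instance Definition _ v := GRing.RMorphism.on (tsq v).
HB.instance Definition _ v := GRing.Linear.on (tsq v).

Lemma tsqX v i : tsq v 'X_i = 'X_i + v *: sqvar i.
Proof. by rewrite /tsq comp_mpolyXU -tnth_nth tnth_mktuple. Qed.
End Substitution.

Lemma mpoly_rmorph_eq (B : comNzRingType) n (S : comNzRingType)
    (f g : {rmorphism {mpoly B[n]} -> S}) :
  (forall b, f b%:MP = g b%:MP) -> (forall i, f 'X_i = g 'X_i) -> f =1 g.
Proof.
move=> fgC fgX p; rewrite [p]mpolyE !rmorph_sum; apply: eq_bigr => m _.
rewrite -mul_mpolyC !rmorphM fgC mpolyXE_id !rmorph_prod; congr (_ * _).
by apply: eq_bigr => i _; rewrite !rmorphXn fgX.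
Qed.

(** Squaring is additive in characteristic 2, so P(v) sends x_{i-1}^2 to x_{i-1}^2 + v^2 x_{i-2}^4.
    Hence the composite depends only on v + w and v^2 w. *)
Lemma tsq_tsqX (B : comNzRingType) (v w : B) i : 2 \in [pchar B] ->
  tsq v (tsq w 'X_i) =
  'X_i + (v + w) *: sqvar B i
  + (v ^+ 2 * w) *: \sum_(j < k.+1 | j.+1 == i) sqvar B j ^+ 2.
Proof.
move=> B2; have M2 : 2 \in [pchar {mpoly B[k.+1]}].
  by rewrite inE /= -mpolyC_nat pcharf0 // mpolyC0.
rewrite tsqX rmorphD /= tsqX linearZ /=.
have -> : tsq v (sqvar B i) =
    sqvar B i + v ^+ 2 *: \sum_(j < k.+1 | j.+1 == i) sqvar B j ^+ 2.
  rewrite /sqvar rmorph_sum scaler_sumr -big_split; apply: eq_bigr => j _ /=.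
  by rewrite rmorphXn /= tsqX -(pFrobenius_autE M2) rmorphD /= !pFrobenius_autE exprZn.
by rewrite scalerDr scalerA scalerDl !addrA [w * _]mulrC.
Qed.

Lemma tsq_comm (B : comNzRingType) (v w v' w' : B) : 2 \in [pchar B] ->
  v + w = v' + w' -> v ^+ 2 * w = v' ^+ 2 * w' ->
  tsq v \o tsq w =1 tsq v' \o tsq w'.
Proof.
move=> B2 e1 e2; apply: mpoly_rmorph_eq => [b|i] /=.
  by rewrite /tsq !comp_mpolyC.
by rewrite !tsq_tsqX // e1 e2.
Qed.

(** As [tsq 1] is the sum of all squares, this is a matrix entry of Sq^i on J for i =
    [mdeg m' - mdeg m]. *)
Definition sqcoef (m m' : 'X_{1..k.+1}) : 'F_2 := (tsq 1 'X_[m])@_m'.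

Notation P2 := {poly 'F_2}.

(* The property of [tsq v 'X_[m]] and [tsq 1 'X_[m]], for d the degree of m, stated so
   as to be stable under products. *)
Definition regraded (v : P2) d (p : {mpoly P2[k.+1]}) (q : {mpoly 'F_2[k.+1]}) :=
  forall m, p@_m = v ^+ (mdeg m - d) * (q@_m)%:P /\
    (q@_m != 0 -> (d <= mdeg m <= d.*2)%N).

(** Where both coefficients are nonzero, the degree bounds exclude truncation in the subtractions,
    so the exponents of v add up. *)
Lemma regradedM v d d' p p' q q' :
  regraded v d p q -> regraded v d' p' q' -> regraded v (d + d') (p * p') (q * q').
Proof.
move=> R R' m; rewrite !mcoeffM; split.
  rewrite rmorph_sum mulr_sumr; apply: eq_bigr => u /eqP mE.
  have {mE} dm : mdeg m = (mdeg u.1 + mdeg u.2)%N by rewrite {1}mE mdegD.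
  have [-> hq] := R u.1; have [-> hq'] := R' u.2; rewrite rmorphM /=.
  have [->|/hq le1] := eqVneq q@_u.1 0; first by rewrite polyC0 !(mulr0,mul0r).
  have [->|/hq' le2] := eqVneq q'@_u.2 0; first by rewrite polyC0 !(mulr0,mul0r).
  have -> : (mdeg m - (d + d') = mdeg u.1 - d + (mdeg u.2 - d'))%N by lia.
  by rewrite exprD; ring.
apply: contraNT => hm; rewrite big1 // => u /eqP mE.
have {mE} dm : mdeg m = (mdeg u.1 + mdeg u.2)%N by rewrite {1}mE mdegD.
have [_ hq] := R u.1; have [_ hq'] := R' u.2.
have [->|/hq le1] := eqVneq q@_u.1 0; first by rewrite mul0r.
have [->|/hq' le2] := eqVneq q'@_u.2 0; first by rewrite mulr0.
by case/negP: hm; lia.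
Qed.

Lemma regraded1 v : regraded v 0 1 1.
Proof.
move=> m; rewrite !mcoeff1; case: eqP => [->|_].
  by rewrite mdeg0 expr0 mul1r polyC1.
by rewrite eqxx polyC0 mulr0.
Qed.

(** The term x_i has degree 1 and comes with v^0; the term x_{i-1}^2 has degree 2 and comes with
    v^1. *)
Lemma regraded_gen v i :
  regraded v 1 ('X_i + v *: sqvar _ i) ('X_i + 1 *: sqvar _ i).
Proof.
have sqE (B : comNzRingType) m : (sqvar B i)@_m =
    (\sum_(j < k.+1 | j.+1 == i) ((U_(j) *+ 2)%MM == m))%N%:R.
  rewrite /sqvar raddf_sum natr_sum; apply: eq_bigr => j _ /=.
  by rewrite mcoeffXn.
have sq_deg m : (\sum_(j < k.+1 | j.+1 == i) ((U_(j) *+ 2)%MM == m) != 0)%N ->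
    mdeg m = 2.
  apply: contraNeq => hm; rewrite big1 // => j _; apply/eqP; rewrite eqb0.
  by apply: contraNneq hm => <-; rewrite mdegMn mdeg1.
move=> m; rewrite !mcoeffD !mcoeffZ !mcoeffX !sqE mul1r; split.
  have [e0|/eqP /eqP /sq_deg dm] := eqVneq
      (\sum_(j < k.+1 | j.+1 == i) ((U_(j) *+ 2)%MM == m))%N 0.
    rewrite e0 mulr0 !addr0; case: eqP => [<-|_]; last by rewrite polyC0 mulr0.
    by rewrite mdeg1 subnn mul1r polyC1.
  rewrite dm expr1; case: eqP => [mE|_]; first by move: dm; rewrite -mE mdeg1.
  by rewrite !add0r rmorph_nat.
case: (U_(i)%MM =P m) => [<-|_]; first by rewrite mdeg1.
by rewrite add0r => hs; rewrite (sq_deg m) //; apply: contraNneq hs => ->.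
Qed.

Lemma regradedX v m : regraded v (mdeg m) (tsq v 'X_[m]) (tsq 1 'X_[m]).
Proof.
rewrite mpolyXE_id [X in regraded _ _ _ (tsq _ X)]mpolyXE_id !rmorph_prod /= mdegE.
elim/big_ind3: _ => [|d p q d' p' q'|i _]; first exact: regraded1.
  exact: regradedM.
rewrite !rmorphXn /= !tsqX; elim: (m i) => [|e IH]; first exact: regraded1.
by rewrite !exprS -add1n; apply: regradedM => //; apply: regraded_gen.
Qed.

(** In other words, P(v) is the generating function \sum_i v^i Sq^i. *)
Lemma tsq_coef (v : P2) m m' :
  (tsq v 'X_[m])@_m' = v ^+ (mdeg m' - mdeg m) * (sqcoef m m')%:P.
Proof. by have [] := regradedX v m m'. Qed.

Lemma sqcoef_deg m m' : sqcoef m m' != 0 -> (mdeg m <= mdeg m' <= (mdeg m).*2)%N.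
Proof. by have [] := regradedX 0 m m'. Qed.

(** P(0) is the identity, and entries between monomials of equal degree do not depend on v. *)
Lemma sqcoef0 m m' : mdeg m = mdeg m' -> sqcoef m m' = (m == m')%:R.
Proof.
move=> dm; have := tsq_coef 0 m m'; rewrite dm subnn expr0 mul1r.
have -> : tsq 0 'X_[m] = 'X_[m] :> {mpoly P2[_]}.
  rewrite /tsq -[RHS]comp_mpoly_id; congr (comp_mpoly _ _).
  by apply: eq_mktuple => i; rewrite scale0r addr0.
by rewrite mcoeffX => /(congr1 (coefp 0)) /=; rewrite coefC /= -polyC_natr coefC.
Qed.
End TotalSquare.

(** * Binomial coefficients mod 2, residues and the Adem relations *)

Lemma poly2_char2 : 2 \in [pchar {poly 'F_2}].
Proof. by rewrite inE /= -polyC_natr polyC_eq0. Qed.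

Lemma natr_F2 (m : nat) : m%:R = (odd m)%:R :> 'F_2.
Proof.
by rewrite -{1}[m]odd_double_half natrD -muln2 natrM (pcharf0 (pchar_Fp _)) ?mulr0 ?addr0.
Qed.

Lemma odd_bin_double e i :
  odd 'C(e.*2, i.*2) = odd 'C(e, i) /\ odd 'C(e.*2, i.*2.+1) = false.
Proof.
elim: e i => [|e IH] [|i]; rewrite ?doubleS ?bin0 //.
  by have [] := IH 0; rewrite !binS !bin0 !oddD /= => _ ->.
have [e1 e2] := IH i; have [e3 e4] := IH i.+1.
rewrite doubleS in e3 e4.
by split; rewrite !binS !oddD ?e1 ?e2 ?e3 ?e4; do 2?case: odd.
Qed.

(** In binary, 2^L - 1 - d is the complement of d, so a digit 1 of d meets a digit 0 and Lucas'
    theorem applies. The induction strips the last digit. *)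
Lemma bin_pow2_sub1 (L : nat) (d : nat) : (0 < d < 2 ^ L)%N ->
  odd 'C(2 ^ L - d - 1, d) = false.
Proof.
elim: L d => [|L IH] d; first by rewrite expn0; lia.
rewrite expnS mul2n -[d]odd_double_half => hd.
have [od|od] := boolP (odd d); rewrite ?add1n ?add0n.
  rewrite (_ : _ - _ - 1 = (2 ^ L - d./2 - 1).*2)%N; last by lia.
  by have [_] := odd_bin_double (2 ^ L - d./2 - 1) d./2.
rewrite (_ : _ - _ - 1 = (2 ^ L - d./2 - 1).*2.+1)%N; last by lia.
have {}IH : odd 'C(2 ^ L - d./2 - 1, d./2) = false by apply: IH; lia.
move: hd; rewrite (negbTE od) add0n => hd.
have dE : d./2 = d./2.-1.+1 by lia.
rewrite {2}dE doubleS binS oddD -doubleS -dE.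
have [-> _] := odd_bin_double (2 ^ L - d./2 - 1) d./2.
by have [_ ->] := odd_bin_double (2 ^ L - d./2 - 1) d./2.-1; rewrite IH.
Qed.

Lemma expr2n_add1 (L : nat) : (1 + 'X : {poly 'F_2}) ^+ (2 ^ L) = 1 + 'X^(2 ^ L).
Proof.
elim: L => [|L IH]; first by rewrite !expn0 !expr1.
rewrite expnSr !exprM IH -!(pFrobenius_autE poly2_char2) rmorphD.
by rewrite rmorph1.
Qed.

Lemma coef_add1_exp (e i : nat) : ((1 + 'X : {poly 'F_2}) ^+ e)`_i = 'C(e, i)%:R.
Proof.
rewrite exprDn coef_sum; under eq_bigr do rewrite expr1n mul1r coefMn coefXn.
have [ie|ei] := ltnP i e.+1.
  rewrite (bigD1 (Ordinal ie)) //= eqxx mulr1n big1 ?addr0 // => j.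
  by rewrite -val_eqE /= eq_sym => /negbTE ->; rewrite mul0rn.
rewrite bin_small // big1 // => j _; rewrite (_ : i == j = false) ?mul0rn //.
by apply/eqP => ij; move: (ltn_ord j); rewrite -ij ltnNge ei.
Qed.

(* The functional [p |-> coefficient of X^a in (1 + X)^(2^L - a - 1) p], which is
   Res (p u^(-a-1) du) for u = X + X^2, reads off the coefficient of u^a. *)
Lemma coef_residue (L a c : nat) : (a < 2 ^ L)%N ->
  ((1 + 'X : {poly 'F_2}) ^+ (2 ^ L - a - 1) * ('X^2 + 'X) ^+ c)`_a
  = (a == c)%:R.
Proof.
move=> aL; have -> : 'X^2 + 'X = 'X * (1 + 'X) :> {poly 'F_2} by ring.
rewrite exprMn mulrCA coefXnM; have [//|ca] := ltnP a c.
  by case: eqP => // <-; rewrite ltnn.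
rewrite -exprD coef_add1_exp; have [<-|] := eqVneq a c; first by rewrite subnn bin0.
move=> ac; have -> : (2 ^ L - a - 1 + c = 2 ^ L - (a - c) - 1)%N by lia.
by rewrite natr_F2 bin_pow2_sub1 //; lia.
Qed.

(** The residue of a term on the other side of the identity. Since (1 + X)^(2^L) = 1 + X^(2^L) and a
    < 2^L, the exponent 2^L drops out and the Adem coefficient remains. *)
Lemma coef_residue_adem (L a b j : nat) : (a < 2 ^ L)%N -> (a < b.*2)%N ->
  ((1 + 'X : {poly 'F_2}) ^+ (2 ^ L - a - 1) * ((1 + 'X) ^+ (a + b - j) * 'X^(j.*2)))`_a
  = if (j <= a./2)%N then 'C(b - j - 1, a - j.*2)%:R else 0.
Proof.
move=> aL ab; rewrite mulrA coefMXn -exprD.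
rewrite (_ : (a < j.*2)%N = ~~ (j <= a./2)%N); last by rewrite -ltnNge; lia.
case: leqP => //= ja.
have -> : (2 ^ L - a - 1 + (a + b - j) = 2 ^ L + (b - j - 1))%N by lia.
rewrite exprD expr2n_add1 mulrDl mul1r coefD coef_add1_exp coefXnM.
by rewrite (_ : (a - j.*2 < 2 ^ L)%N) ?addr0 //; lia.
Qed.

(** Apply the residue functional to both sides: on the left it selects the exponent a + b - j = a,
    that is j = b; on the right it yields the Adem coefficients. *)
Lemma adem_of_generating (C : nat -> 'F_2) a b :
  (\sum_(j < (a + b).+1) (C j)%:P * ('X^2 + 'X) ^+ (a + b - j) =
   \sum_(j < (a + b).+1) (C j)%:P * ((1 + 'X) ^+ (a + b - j) * 'X^(j.*2))) ->
  (a < b.*2)%N -> C b = \sum_(j < a./2.+1) 'C(b - j - 1, a - j.*2)%:R * C j.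
Proof.
(* Any L with a < 2^L serves, and a < 2^a. *)
move=> gen ab; pose L := a.
have aL : (a < 2 ^ L)%N by apply: ltn_expl.
have := congr1 (fun p : {poly 'F_2} => ((1 + 'X) ^+ (2 ^ L - a - 1) * p)`_a) gen.
rewrite !mulr_sumr !coef_sum.
under eq_bigr do rewrite mulrCA coefCM coef_residue //.
under [RHS]eq_bigr do rewrite mulrCA coefCM coef_residue_adem //.
have bN : (b < (a + b).+1)%N by lia.
rewrite (bigD1 (Ordinal bN)) //= addnK eqxx mulr1 big1 ?addr0; last first.
  move=> j; rewrite -val_eqE /= => jb.
  rewrite (_ : a == _ = false) ?mulr0 //; apply/negbTE; move: jb; case: j => j /=; lia.
move=> ->.
rewrite (big_ord_widen (a + b).+1 (fun j => 'C(b - j - 1, a - j.*2)%:R * C j));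
  last by lia.
rewrite [RHS]big_mkcond; apply: eq_bigr => j _; rewrite ltnS mulrC.
by case: ifP; rewrite ?mul0r.
Qed.

Definition deg_incr (B : nzRingType) n l (L : {mpoly B[n]} -> {mpoly B[l]}) :=
  forall m m', (L 'X_[m])@_m' != 0 -> (mdeg m <= mdeg m')%N.

(** Monomials of degree at least N cannot reach m', so matrix products can be taken over the finite
    type of bounded monomials. *)
Lemma deg_incr_expand (B : comNzRingType) n l (L : {linear {mpoly B[n]} -> {mpoly B[l]}})
    N m' (p : {mpoly B[n]}) : deg_incr L -> (mdeg m' < N)%N ->
  (L p)@_m' = \sum_(m : 'X_{1..n < N}) p@_m * (L 'X_[m])@_m'.
Proof.
move=> incL mN; rewrite {1}[p]mpolyE linear_sum raddf_sum /=.
under eq_bigr do rewrite linearZ mcoeffZ.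
under [RHS]eq_bigr do rewrite {1}[p]mpolyE raddf_sum mulr_suml /=.
rewrite exchange_big /=; apply: eq_bigr => u _.
under eq_bigr do rewrite mcoeffZ mcoeffX.
have [uN|Nu] := ltnP (mdeg u) N.
  rewrite (bigD1 (BMultinom uN)) //= eqxx mulr1 big1 ?addr0 // => v.
  by rewrite -val_eqE /= eq_sym => /negbTE -> /=; rewrite mulr0 mul0r.
rewrite big1 => [|v _]; last first.
  rewrite (_ : u == v = false) /= ?mulr0 ?mul0r //; apply/negbTE.
  by apply: contraTneq Nu => ->; rewrite -ltnNge bmdeg.
apply/eqP; have [->|/incL um'] := eqVneq ((L 'X_[u])@_m') 0; first by rewrite mulr0.
by have := leq_trans Nu um'; rewrite leqNgt mN.
Qed.

Lemma tsq_deg_incr k (v : {poly 'F_2}) : deg_incr (@tsq k _ v).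
Proof.
move=> m m'; rewrite tsq_coef; apply: contraNT => mm'.
have [->|/sqcoef_deg] := eqVneq (sqcoef m m') 0; first by rewrite polyC0 mulr0.
by rewrite (negbTE mm').
Qed.

(** Group the intermediate monomials u by j = |u| - |m|: P(w) contributes w^j and P(v) contributes
    v^(a+b-j). So [C j] is an entry of Sq^(a+b-j) Sq^j. *)
Lemma tsq_tsq_coef k N (m m' : 'X_{1..k.+1}) (a b : nat) (v w : {poly 'F_2})
    (C := fun j => \sum_(u : 'X_{1..k.+1 < N} | mdeg u == (mdeg m + j)%N)
                     sqcoef m u * sqcoef u m') :
  (mdeg m' < N)%N -> mdeg m' = (mdeg m + (a + b))%N ->
  (tsq v (tsq w 'X_[m]))@_m' =
    \sum_(j < (a + b).+1) (C j)%:P * (v ^+ (a + b - j) * w ^+ j).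
Proof.
move=> mN dm.
  rewrite (deg_incr_expand _ (@tsq_deg_incr k v) mN).
  under [RHS]eq_bigr do rewrite rmorph_sum mulr_suml.
  rewrite (exchange_big_dep xpredT) //=; apply: eq_bigr => u _.
  rewrite !tsq_coef.
  move: (@sqcoef_deg k m u) (@sqcoef_deg k u m').
  move: (sqcoef m u) (sqcoef u m') => x y hx hy.
  have [x0|/hx /andP[mu _]] := eqVneq x 0.
    by rewrite {}x0 polyC0 mulr0 mul0r big1 // => j _; rewrite mul0r polyC0 mul0r.
  have [y0|/hy /andP[um' _]] := eqVneq y 0.
    by rewrite {}y0 polyC0 !mulr0 big1 // => j _; rewrite polyC0 mul0r.
  have jlt : (mdeg u - mdeg m < (a + b).+1)%N by lia.
  rewrite (big_pred1 (Ordinal jlt)) /=; last first.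
    by move=> j /=; rewrite -val_eqE /=; lia.
  rewrite polyCM (_ : mdeg m' - mdeg u = a + b - (mdeg u - mdeg m))%N; last by lia.
  by rewrite mulrACA [RHS]mulrC [_ ^+ _ * _ ^+ _ in LHS]mulrC.
Qed.

Lemma sqcoef_adem k N (m m' : 'X_{1..k.+1}) (a b : nat)
    (C := fun j => \sum_(u : 'X_{1..k.+1 < N} | mdeg u == (mdeg m + j)%N)
                     sqcoef m u * sqcoef u m') :
  (mdeg m' < N)%N -> mdeg m' = (mdeg m + (a + b))%N -> (a < b.*2)%N ->
  C b = \sum_(j < a./2.+1) 'C(b - j - 1, a - j.*2)%:R * C j.
Proof.
move=> mN dm ab; apply: adem_of_generating => //.
pose t : {poly 'F_2} := 'X.
(* Both composites have v + w = 1 + t + t^2 and v^2 w = t^2 + t^4. *)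
have eqT : tsq (t ^+ 2 + t) (tsq 1 'X_[m]) = tsq (1 + t) (tsq (t ^+ 2) 'X_[m]).
  apply: (tsq_comm poly2_char2); ring.
have := tsq_tsq_coef (t ^+ 2 + t) 1 mN dm; rewrite eqT (tsq_tsq_coef _ _ mN dm) => gen.
transitivity (\sum_(j < (a + b).+1) (C j)%:P * (('X^2 + 'X) ^+ (a + b - j) * 1 ^+ j)).
  by apply: eq_bigr => j _; rewrite expr1n mulr1.
rewrite -[LHS]gen; apply: eq_bigr => j _.
by rewrite -exprM mul2n.
Qed.

Lemma sum_mulA (R : comNzRingType) (S T : finType) (P : pred S) (Q : pred T)
    (Q' : S -> pred T) (f : T -> R) (c : S -> R) (d : S -> T -> R) :
  (forall u, P u -> Q' u =1 Q) ->
  \sum_(u | P u) (\sum_(v | Q' u v) f v * d u v) * c u =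
  \sum_(v | Q v) f v * \sum_(u | P u) c u * d u v.
Proof.
move=> PQ; under [RHS]eq_bigr do rewrite mulr_sumr.
rewrite exchange_big /=; apply: eq_bigr => u Pu; rewrite mulr_suml.
by apply: eq_big => [v|v _]; [exact: PQ | rewrite -mulrA [c u * _]mulrC].
Qed.

(* The module of functionals on polynomials in x_0, ..., x_k that vanish on the
   monomials of degree at least N. A functional is given by its values on the
   monomials of degree less than N; the bounds make it a finite module. *)
Section DualModule.
Variables k N : nat.

Notation mon := ('X_{1..k.+1 < N})%type.
Notation dual := ({ffun mon -> ('F_2)^o})%type.

Definition dual_pr (n : int) (f : dual) : dual :=
  [ffun m : mon => if (mdeg m)%:Z == n then f m else 0].

Fact dual_pr_linear n : linear (dual_pr n).
Proof.
move=> a f g; apply/ffunP => m; rewrite !ffunE.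
by case: ifP => _; rewrite ?scaler0 ?addr0.
Qed.

HB.instance Definition _ n := GRing.isLinear.Build 'F_2 dual dual _ (dual_pr n)
  (dual_pr_linear n).

(** The transpose of Sq^i: the value on x^m is f(Sq^i x^m), where f vanishes in degrees at least
    N. *)
Definition dual_Sq (i : nat) (f : dual) : dual :=
  [ffun m : mon => \sum_(m' : mon | mdeg m' == (mdeg m + i)%N) (f m' : 'F_2) * sqcoef m m'].

Lemma dual_SqE i f m : dual_Sq i f m =
  \sum_(m' : mon | mdeg m' == (mdeg m + i)%N) (f m' : 'F_2) * sqcoef m m'.
Proof. exact: ffunE. Qed.

Fact dual_Sq_linear i : linear (dual_Sq i).
Proof.
move=> a f g; apply/ffunP => m; rewrite !ffunE scaler_sumr -big_split.
by apply: eq_bigr => m' _; rewrite !ffunE /= mulrDl scalerAl.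
Qed.

HB.instance Definition _ i := GRing.isLinear.Build 'F_2 dual dual _ (dual_Sq i)
  (dual_Sq_linear i).

Fact dual_pr_pr m n f : dual_pr m (dual_pr n f) = if m == n then dual_pr n f else 0.
Proof.
apply/ffunP => u; rewrite !ffunE; case: (m =P n) => [->|mn]; rewrite !ffunE.
  by case: eqP.
by case: eqP => // ->; case: eqP.
Qed.

Fact dual_pr_sum f : exists2 t : seq int, uniq t & f = \sum_(n <- t) dual_pr n f.
Proof.
exists [seq Posz j | j <- iota 0 N].
  by rewrite map_inj_uniq ?iota_uniq // => i j [].
apply/ffunP => m; rewrite sum_ffunE big_map.
under eq_bigr do rewrite ffunE eqz_nat.
rewrite (bigD1_seq (mdeg m)) ?iota_uniq ?mem_iota ?add0n ?bmdeg //= eqxx.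
by rewrite big1 ?addr0 // => j; rewrite eq_sym => /negbTE ->.
Qed.

Fact dual_Sq_pr i n f : dual_Sq i (dual_pr n f) = dual_pr (n - i%:Z) (dual_Sq i f).
Proof.
apply/ffunP => m; rewrite !ffunE.
under eq_bigr => m' /eqP dm' do rewrite ffunE dm' PoszD.
have -> : ((mdeg m)%:Z == n - i%:Z) = ((mdeg m)%:Z + i%:Z == n).
  by rewrite eq_sym subr_eq eq_sym.
case: ifP => // _; rewrite big1 // => m' _; exact: mul0r.
Qed.

Fact dual_Sq_0 f : dual_Sq 0 f = f.
Proof.
apply/ffunP => m; rewrite ffunE addn0 (bigD1 m) //= sqcoef0 // eqxx mulr1.
rewrite big1 ?addr0 // => m' /andP[/eqP dm' m'm].
by move: m'm; rewrite sqcoef0 // bmeqP eq_sym => /negbTE ->; rewrite mulr0.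
Qed.

Lemma dual_Sq_Sq a b f (m : mon) :
  dual_Sq b (dual_Sq a f) m =
  \sum_(m' : mon | mdeg m' == (mdeg m + (a + b))%N)
    (f m' : 'F_2) * \sum_(u : mon | mdeg u == (mdeg m + b)%N) sqcoef m u * sqcoef u m'.
Proof.
rewrite dual_SqE; transitivity (\sum_(u : mon | mdeg u == (mdeg m + b)%N)
    (\sum_(m' : mon | mdeg m' == (mdeg u + a)%N) (f m' : 'F_2) * sqcoef u m') *
    sqcoef m u).
  by apply: eq_bigr => u _; congr (_ * _); apply: dual_SqE.
apply: (sum_mulA (f : mon -> 'F_2)) => u /eqP -> m'.
by rewrite -addnA [(b + a)%N]addnC.
Qed.

Fact dual_Adem a b f : (0 < a)%N -> (a < b.*2)%N ->
  dual_Sq b (dual_Sq a f) =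
  \sum_(j < a./2.+1)
    'C(b - j - 1, a - j.*2)%:R *: dual_Sq j (dual_Sq (a + b - j) f).
Proof.
move=> _ ab; apply/ffunP => m; rewrite sum_ffunE dual_Sq_Sq.
pose C j m' := \sum_(u : mon | mdeg u == (mdeg m + j)%N) sqcoef m u * sqcoef u m'.
transitivity (\sum_(m' : mon | mdeg m' == (mdeg m + (a + b))%N)
    \sum_(j < a./2.+1) (f m' : 'F_2) * ('C(b - j - 1, a - j.*2)%:R * C j m')).
  apply: eq_bigr => m' /eqP dm'; rewrite -mulr_sumr.
  by congr (_ * _); apply: sqcoef_adem (bmdeg m') dm' ab.
rewrite exchange_big; apply: eq_bigr => j _ /=.
transitivity ('C(b - j - 1, a - j.*2)%:R *
    \sum_(m' : mon | mdeg m' == (mdeg m + (a + b))%N) (f m' : 'F_2) * C j m').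
  by rewrite mulr_sumr; apply: eq_bigr => m' _; rewrite mulrCA.
rewrite ffunE; congr (_ * _); rewrite dual_Sq_Sq subnK //.
by have := ltn_ord j; lia.
Qed.

(** The module is a finite set, so the list of all its elements spans. *)
Fact dual_lfinite f : exists b : seq dual, forall w, exists c : nat -> 'F_2,
  Sq_word dual_Sq w f = \sum_(i < size b) c i *: b`_i.
Proof.
pose b : seq dual := enum {: {ffun mon -> 'F_2} }.
exists b => w; set y := Sq_word _ _ _.
have yb : y \in b by rewrite mem_enum.
exists (fun i => (i == index y b)%:R).
have ib : (index y b < size b)%N by rewrite index_mem.
rewrite (bigD1 (Ordinal ib)) //= eqxx scale1r nth_index // big1 ?addr0 // => i.
by rewrite -val_eqE /= => /negbTE ->; rewrite scale0r.
Qed.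

Definition dual_mod : stmod :=
  @Stmod _ (fun n => dual_pr n : {linear dual -> dual})
    (fun i => dual_Sq i : {linear dual -> dual})
    dual_pr_pr dual_pr_sum dual_Sq_pr dual_Sq_0 dual_Adem dual_lfinite.
End DualModule.

Notation dual_of k N := ({ffun 'X_{1..k.+1 < N} -> ('F_2)^o})%type.

Section DualClass.
Variables k N : nat.

Definition dual_iota (n : nat) : dual_mod k N :=
  [ffun m : 'X_{1..k.+1 < N} => ((m : 'X_{1..k.+1}) == U_(ord0) *+ n)%MM%:R].

Lemma dual_iota_homog n : Defs.homog n%:Z (dual_iota n).
Proof.
apply/ffunP => m; rewrite !ffunE; case: eqP => // mn; case: eqP => // mE.
by case: mn; rewrite mE mdegMn mdeg1 mul1n.
Qed.

(** The total square at most doubles degrees, so Sq^i x^m = 0 for i > |m|. If f has degree n, then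
    |m| = n - i, and i > |m| means 2i > n. *)
Lemma dual_unstable : unstable (dual_mod k N).
Proof.
move=> n i f fn ni; apply/ffunP => m; rewrite /= dual_SqE ffunE big1 // => m' /eqP dm'.
have [->|/sqcoef_deg dm] := eqVneq (sqcoef m m') 0; first by rewrite mulr0.
rewrite -fn /= ffunE; case: eqP => [e|_]; last by rewrite mul0r.
by move: ni; rewrite -e ltz_nat; lia.
Qed.

Lemma dual_iota_neq0 n : (n < N)%N -> dual_iota n != 0.
Proof.
move=> nN; have dN : (mdeg (U_(ord0) *+ n : 'X_{1..k.+1}) < N)%N.
  by rewrite mdegMn mdeg1 mul1n.
apply/eqP => /ffunP/(_ (BMultinom dN)); rewrite !ffunE eqxx; exact/eqP.
Qed.

Lemma sum_dual_iota n (c : 'X_{1..k.+1} -> 'F_2) (P : pred 'X_{1..k.+1 < N})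
    (Q : bool) : (n < N)%N ->
  (forall u : 'X_{1..k.+1 < N}, (u : 'X_{1..k.+1}) = (U_(ord0) *+ n)%MM -> P u = Q) ->
  \sum_(u : 'X_{1..k.+1 < N} | P u) (dual_iota n u : 'F_2) * c u =
  if Q then c (U_(ord0) *+ n)%MM else 0.
Proof.
move=> nN PQ; have dN : (mdeg (U_(ord0) *+ n : 'X_{1..k.+1}) < N)%N.
  by rewrite mdegMn mdeg1 mul1n.
rewrite -(PQ (BMultinom dN) erefl) big_mkcond (bigD1 (BMultinom dN)) //=.
rewrite big1 ?addr0 => [|u]; first by rewrite ffunE eqxx mul1r.
by rewrite bmeqP /= ffunE => /negbTE ->; rewrite mul0r; case: ifP.
Qed.
End DualClass.

(** * Transposes of maps commuting with the total square *)

Section DualMap.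
Variables (k l N e : nat) (L : {linear {mpoly 'F_2[l.+1]} -> {mpoly 'F_2[k.+1]}}).
Hypothesis Ldeg : forall m m', (L 'X_[m])@_m' != 0 -> mdeg m' = (mdeg m + e)%N.
Hypothesis Ltsq : forall m, L (tsq 1 'X_[m]) = tsq 1 (L 'X_[m]).

Definition dual_map (f : dual_of k N) : dual_of l N :=
  [ffun m : 'X_{1..l.+1 < N} =>
     \sum_(u : 'X_{1..k.+1 < N}) (f u : 'F_2) * (L 'X_[m])@_u].

Lemma dual_mapE f m : dual_map f m =
  \sum_(u : 'X_{1..k.+1 < N}) (f u : 'F_2) * (L 'X_[m])@_u.
Proof. exact: ffunE. Qed.

Fact dual_map_linear : linear dual_map.
Proof.
move=> a f g; apply/ffunP => m; rewrite !ffunE scaler_sumr -big_split.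
by apply: eq_bigr => m' _; rewrite !ffunE /= mulrDl scalerAl.
Qed.

HB.instance Definition _ := GRing.isLinear.Build 'F_2 _ _ _ dual_map
  dual_map_linear.

Lemma dual_map_pr n f : dual_map (dual_pr n f) = dual_pr (n - e%:Z) (dual_map f).
Proof.
apply/ffunP => m; rewrite !ffunE.
have -> : ((mdeg m)%:Z == n - e%:Z) = ((mdeg m + e)%:Z == n).
  by rewrite eq_sym subr_eq eq_sym PoszD.
transitivity (\sum_(u : 'X_{1..k.+1 < N})
    (if (mdeg m + e)%:Z == n then f u : 'F_2 else 0) * (L 'X_[m])@_u).
  apply: eq_bigr => u _; rewrite ffunE.
  by have [->|/Ldeg ->] := eqVneq ((L 'X_[m])@_u) 0; rewrite ?mulr0.
by case: ifP => // _; rewrite big1 // => u _; rewrite mul0r.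
Qed.

(** Both sides evaluate f on the part of degree |m| + e + i of L(P(1) x^m) = P(1)(L x^m). As L
    raises degrees by exactly e, the sums over intermediate monomials of one degree can be extended
    to all bounded monomials. *)
Lemma dual_map_Sq i f : dual_map (dual_Sq i f) = dual_Sq i (dual_map f).
Proof.
apply/ffunP => m; rewrite dual_mapE dual_SqE.
pose Q (v : 'X_{1..k.+1 < N}) := mdeg v == (mdeg m + e + i)%N.
transitivity (\sum_(v | Q v) (f v : 'F_2) *
    \sum_(u : 'X_{1..k.+1 < N} | mdeg u == (mdeg m + e)%N) (L 'X_[m])@_u * sqcoef u v).
  rewrite -(sum_mulA (Q' := fun u v : 'X_{1..k.+1 < N} => mdeg v == (mdeg u + i)%N));
    last first.
    by move=> u /eqP ->.
  rewrite [LHS](bigID (fun u : 'X_{1..k.+1 < N} => mdeg u == (mdeg m + e)%N)) /=.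
  rewrite [X in _ + X]big1 ?addr0 => [|u hu].
    by apply: eq_bigr => u _; rewrite dual_SqE.
  have [->|/Ldeg/eqP] := eqVneq ((L 'X_[m])@_u) 0; first by rewrite mulr0.
  by rewrite (negbTE hu).
transitivity (\sum_(v | Q v) (f v : 'F_2) *
    \sum_(u : 'X_{1..l.+1 < N} | mdeg u == (mdeg m + i)%N) sqcoef m u * (L 'X_[u])@_v).
  apply: eq_bigr => v Qv; congr (_ * _).
  transitivity ((tsq 1 (L 'X_[m]))@_v).
    rewrite (@deg_incr_expand _ _ _ (tsq 1) N) ?bmdeg //; last first.
      by move=> u u' /sqcoef_deg /andP[].
    rewrite big_rmcond // => u hu.
    by have [->|/Ldeg/eqP] := eqVneq ((L 'X_[m])@_u) 0; rewrite ?mul0r ?(negbTE hu).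
  rewrite -Ltsq (@deg_incr_expand _ _ _ L N) ?bmdeg //; last first.
    by move=> u u' /Ldeg ->; rewrite leq_addr.
  rewrite [RHS]big_rmcond // => u hu.
  have [->|/Ldeg] := eqVneq ((L 'X_[u])@_v) 0; first by rewrite mulr0.
  by rewrite (eqP Qv) => uv; case/eqP: hu; lia.
rewrite -(sum_mulA (Q' := fun (u : 'X_{1..l.+1 < N}) (v : 'X_{1..k.+1 < N}) =>
    mdeg v == (mdeg u + e)%N)); last first.
  by move=> u /eqP -> v; rewrite /Q addnAC.
apply: eq_bigr => u _; congr (_ * _); rewrite dual_mapE big_rmcond // => v hv.
by have [->|/Ldeg/eqP] := eqVneq ((L 'X_[u])@_v) 0; rewrite ?mulr0 ?(negbTE hv).
Qed.

Lemma dual_map_iota n (m : 'X_{1..l.+1 < N}) : (n < N)%N ->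
  dual_map (dual_iota k N n) m = (L 'X_[m])@_(U_(ord0) *+ n).
Proof.
by move=> nN; rewrite dual_mapE (sum_dual_iota (fun u => (L 'X_[m])@_u) (Q := true)).
Qed.
End DualMap.

(** * Multiplication by x_0 and the shift of variables *)

Section MulX0.
Variable k : nat.

Definition mulX0 (p : {mpoly 'F_2[k.+1]}) : {mpoly 'F_2[k.+1]} := 'X_ord0 * p.

Fact mulX0_linear : linear mulX0.
Proof. by move=> a p q; rewrite /mulX0 mulrDr scalerAr. Qed.

HB.instance Definition _ := GRing.isLinear.Build 'F_2 _ _ _ mulX0 mulX0_linear.

Lemma mulX0_coef m m' : (mulX0 'X_[m])@_m' = ((U_(ord0) + m)%MM == m')%:R.
Proof. by rewrite /mulX0 -mpolyXD mcoeffX. Qed.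

Lemma mulX0_deg m m' : (mulX0 'X_[m])@_m' != 0 -> mdeg m' = (mdeg m + 1)%N.
Proof.
rewrite mulX0_coef; case: ((U_(ord0) + m)%MM =P m') => [<- _|_];
  last by rewrite eqxx.
by rewrite mdegD mdeg1 addnC. Qed.

(** The total square is multiplicative and fixes x_0, because x_{-1} = 0. *)
Lemma mulX0_tsq m : mulX0 (tsq 1 'X_[m]) = tsq 1 (mulX0 'X_[m]).
Proof.
rewrite /mulX0 rmorphM /= [tsq 1 'X_ord0]tsqX /sqvar big_pred0 ?scaler0 ?addr0 //.
Qed.

Variable N : nat.

Definition dual_p : stHom (dual_mod k N) (susp 1 (dual_mod k N)) :=
  @StHom (dual_mod k N) (susp 1 (dual_mod k N)) (@dual_map k k N mulX0)
    (dual_map_pr mulX0_deg) (dual_map_Sq mulX0_deg mulX0_tsq).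

Lemma dual_p_iota n : (n.+1 < N)%N ->
  dual_p (dual_iota k N n.+1) = dual_iota k N n.
Proof.
move=> nN; apply/ffunP => m; rewrite /= dual_map_iota // mulX0_coef ffunE.
by rewrite mulmS (inj_eq (@addmI _ _)).
Qed.
End MulX0.

Section Shift.
Variable k : nat.

Definition shift_mpoly : {mpoly 'F_2[k.+2]} -> {mpoly 'F_2[k.+1]} :=
  comp_mpoly [tuple (if unlift ord0 i is Some j then 'X_j else 0) | i < k.+2].

HB.instance Definition _ := GRing.RMorphism.on shift_mpoly.
HB.instance Definition _ := GRing.Linear.on shift_mpoly.

Lemma shift_mpolyX0 : shift_mpoly 'X_ord0 = 0.
Proof. by rewrite /shift_mpoly comp_mpolyXU -tnth_nth tnth_mktuple unlift_none. Qed.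

Lemma shift_mpolyXS j : shift_mpoly 'X_(lift ord0 j) = 'X_j.
Proof. by rewrite /shift_mpoly comp_mpolyXU -tnth_nth tnth_mktuple liftK. Qed.

Lemma shift_mpolyX m : shift_mpoly 'X_[m] =
  if m ord0 == 0%N then 'X_[ [multinom m (lift ord0 j) | j < k.+1] ] else 0.
Proof.
rewrite [in LHS]mpolyXE_id rmorph_prod big_ord_recl rmorphXn /= shift_mpolyX0 expr0n.
case: eqP => _; last by rewrite mul0r.
rewrite mul1r [RHS]mpolyXE_id; apply: eq_bigr => j _.
by rewrite rmorphXn /= shift_mpolyXS mnmE.
Qed.

Lemma shift_mpoly_deg m m' : (shift_mpoly 'X_[m])@_m' != 0 -> mdeg m' = (mdeg m + 0)%N.
Proof.
rewrite shift_mpolyX addn0; case: (m ord0 =P 0%N) => [m0|_];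
  last by rewrite mcoeff0 eqxx.
rewrite mcoeffX; case: ((_ : 'X_{1..k.+1}) =P m') => [<- _|_]; last by rewrite eqxx.
rewrite !mdegE [RHS]big_ord_recl m0 add0n.
by apply: eq_bigr => j _; rewrite mnmE.
Qed.

(** Compare on generators: the only special case is x_1 + x_0^2, which goes to x_0 because the shift
    kills x_0. *)
Lemma shift_mpoly_tsq p : shift_mpoly (tsq 1 p) = tsq 1 (shift_mpoly p).
Proof.
apply: (@mpoly_rmorph_eq _ _ _ (shift_mpoly \o tsq 1) (tsq 1 \o shift_mpoly)) => [b|i] /=.
  by rewrite /tsq /shift_mpoly !comp_mpolyC.
rewrite tsqX scale1r rmorphD /= /sqvar rmorph_sum big_mkcond big_ord_recl /=.
under eq_bigr do rewrite rmorphXn /= shift_mpolyXS.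
case: (unliftP ord0 i) => [j ->|->].
  rewrite shift_mpolyXS tsqX scale1r /sqvar rmorphXn /= shift_mpolyX0 expr0n /=.
  by rewrite if_same add0r -big_mkcond.
by rewrite shift_mpolyX0 raddf0 !add0r; apply: big1.
Qed.

(** Setting all variables but x_0 to 0 is a ring homomorphism that retains the coefficients of the
    powers of x_0, so these can be computed factor by factor. *)
Definition eval_X0 l : {mpoly 'F_2[l.+1]} -> {poly 'F_2} :=
  mmap (@polyC _) (fun i => if i == ord0 then 'X else 0).

HB.instance Definition _ l := GRing.RMorphism.on (@eval_X0 l).

Lemma eval_X0_var l (i : 'I_l.+1) : eval_X0 'X_i = if i == ord0 then 'X else 0.
Proof. by rewrite /eval_X0 mmapX mmap1U. Qed.

Lemma coef_eval_X0 l n (p : {mpoly 'F_2[l.+1]}) :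
  (eval_X0 p)`_n = p@_(U_(ord0) *+ n).
Proof.
rewrite {1}/eval_X0 /mmap coef_sum [in RHS](mpolyE p) raddf_sum.
apply: eq_bigr => m _ /=; rewrite coefCM mcoeffZ mcoeffX; congr (_ * _).
rewrite /mmap1 big_ord_recl eqxx.
have UE (i : 'I_l) : (U_(ord0) *+ n : 'X_{1..l.+1})%MM (lift ord0 i) = 0%N.
  by rewrite mulmnE mnm1E.
have U0 : (U_(ord0) *+ n : 'X_{1..l.+1})%MM ord0 = n by rewrite mulmnE mnm1E eqxx mul1n.
have [/forallP m0|/forallPn[j mj]] := boolP [forall j : 'I_l, m (lift ord0 j) == 0%N].
  rewrite big1 => [|j _]; last by rewrite (eqP (m0 j)) expr0.
  rewrite mulr1 coefXn; congr (_%:R); congr nat_of_bool; apply/eqP/eqP => [nm|->];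
    last first.
    by rewrite U0.
  apply/mnmP => i; case: (unliftP ord0 i) => [j ->|->]; last by rewrite U0.
  by rewrite UE (eqP (m0 j)).
rewrite (bigD1 j) //= expr0n (negbTE mj) mul0r mulr0 coef0.
by case: eqP => // mE; case/negP: mj; rewrite mE UE.
Qed.

(** Both sides are 1 exactly for x^m = x_1^n. After evaluation the total square sends x_0 to X and
    x_1 to X^2, the shift sends x_0 to 0 and x_1 to X, and both kill the other variables. With a + b
    = n, the equation a + 2b = 2n forces a = 0. *)
Lemma shift_mpoly_top m n : mdeg m = n ->
  (shift_mpoly 'X_[m])@_(U_(ord0) *+ n) = sqcoef m (U_(ord0) *+ n.*2).
Proof.
move=> dm; rewrite /sqcoef -!coef_eval_X0.
(* The common contribution of x_2, x_3, ...: it is 1 if none of them occurs in x^m, and 0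
   otherwise. *)
pose Z : {poly 'F_2} := \prod_(j < k) 0 ^+ m (lift ord0 (lift ord0 j)).
pose a := m ord0; pose b := m (lift ord0 ord0).
have evq (i : 'I_k.+2) : eval_X0 (sqvar 'F_2 i) = if i == 1%N :> nat then 'X^2 else 0.
  rewrite /sqvar rmorph_sum big_mkcond big_ord_recl /= rmorphXn /= eval_X0_var eqxx.
  rewrite big1 ?addr0 => [|j _]; first by rewrite eq_sym.
  by rewrite rmorphXn /= eval_X0_var expr0n; case: ifP.
have evt (i : 'I_k.+2) : eval_X0 (tsq 1 'X_i) =
    (if i == ord0 then 'X else 0) + (if i == 1%N :> nat then 'X^2 else 0).
  by rewrite tsqX scale1r rmorphD /= evq eval_X0_var.
have -> : eval_X0 (tsq 1 'X_[m]) = 'X^(a + b.*2) * Z.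
  transitivity (\prod_(i < k.+2)
      ((if i == ord0 then 'X else 0) + (if i == 1%N :> nat then 'X^2 else 0) : {poly 'F_2}) ^+ m i).
    rewrite mpolyXE_id !rmorph_prod; apply: eq_bigr => i _.
    by rewrite -evt -!rmorphXn.
  rewrite !big_ord_recl /= !addr0 add0r mulrA; congr (_ * _).
    by rewrite -exprM mul2n exprD.
have evs (i : 'I_k.+2) : eval_X0 (shift_mpoly 'X_i) =
    (if i == 1%N :> nat then 'X else 0).
  case: (unliftP ord0 i) => [j ->|->]; first by rewrite shift_mpolyXS eval_X0_var.
  by rewrite shift_mpolyX0 raddf0.
have -> : eval_X0 (shift_mpoly 'X_[m]) = 0 ^+ a * 'X^b * Z.
  transitivity (\prod_(i < k.+2) (if i == 1%N :> nat then 'X else 0 : {poly 'F_2}) ^+ m i).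
    rewrite mpolyXE_id !rmorph_prod; apply: eq_bigr => i _.
    by rewrite -evs -!rmorphXn.
  by rewrite !big_ord_recl /= mulrA.
have [/forallP m0|/forallPn[j mj]] :=
    boolP [forall j : 'I_k, m (lift ord0 (lift ord0 j)) == 0%N]; last first.
  have -> : Z = 0 by rewrite /Z (bigD1 j) //= expr0n (negbTE mj) mul0r.
  by rewrite !mulr0 !coef0.
have -> : Z = 1 by rewrite /Z big1 // => j _; rewrite (eqP (m0 j)).
move: dm; rewrite mdegE !big_ord_recl big1 => [dm|j _]; last exact/eqP.
rewrite !mulr1 expr0n coefXn -/a -/b addn0 in dm *.
have [a0|a0] := eqVneq a 0%N; first by rewrite mul1r coefXn; congr (_%:R);
  congr nat_of_bool; lia.
by rewrite mul0r coef0; case: eqP => //; lia.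
Qed.

Variable N : nat.

Lemma shift_map_pr n f :
  dual_map shift_mpoly (dual_pr n f) = dual_pr n (dual_map shift_mpoly f) :> dual_of k.+1 N.
Proof. by rewrite (dual_map_pr shift_mpoly_deg) subr0. Qed.

Definition dual_shift : stHom (dual_mod k N) (dual_mod k.+1 N) :=
  @StHom (dual_mod k N) (dual_mod k.+1 N) (@dual_map k k.+1 N shift_mpoly)
    shift_map_pr
    (dual_map_Sq shift_mpoly_deg (fun m => shift_mpoly_tsq 'X_[m])).

(** Each x^m is the shift of a monomial of the same degree, obtained by raising all indices by one,
    so the transpose still sees the value at m. *)
Lemma dual_shift_inj : injective dual_shift.
Proof.
move=> f g /ffunP fg; apply/ffunP => m.
pose m1 : 'X_{1..k.+2} :=
  [multinom (if unlift ord0 i is Some j then (m : 'X_{1..k.+1}) j else 0%N) | i < k.+2].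
have m10 : m1 ord0 = 0%N by rewrite mnmE unlift_none.
have m1S j : m1 (lift ord0 j) = (m : 'X_{1..k.+1}) j by rewrite mnmE liftK.
have dm1 : (mdeg m1 < N)%N.
  rewrite mdegE big_ord_recl m10 add0n; apply: leq_trans (bmdeg m).
  by rewrite mdegE ltnS; apply: eq_leq; apply: eq_bigr => j _.
have shE : shift_mpoly 'X_[m1] = 'X_[m].
  by rewrite shift_mpolyX m10 eqxx; congr 'X_[_]; apply/mnmP => j; rewrite mnmE m1S.
have dualE (h : dual_of k N) : dual_map shift_mpoly h (BMultinom dm1) = h m.
  rewrite dual_mapE /= shE (bigD1 m) //= mcoeffX eqxx mulr1 big1 ?addr0 // => u.
  by rewrite bmeqP mcoeffX eq_sym => /negbTE ->; rewrite mulr0.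
by have := fg (BMultinom dm1); rewrite /= !dualE.
Qed.

Lemma dual_shift_iota n : (n.*2 < N)%N ->
  dual_shift (dual_iota k N n) = Sq n (dual_iota k.+1 N n.*2).
Proof.
move=> nN; apply/ffunP => m; rewrite /= dual_SqE dual_map_iota; last by lia.
rewrite (@sum_dual_iota _ _ _ (fun u => sqcoef m u) _ (n.*2 == mdeg m + n)%N) //;
  last first.
  by move=> u ->; rewrite mdegMn mdeg1 mul1n.
have [dm|dm] := eqVneq n.*2 (mdeg m + n)%N; first by apply: shift_mpoly_top; lia.
apply/eqP; apply: contraNT dm => /shift_mpoly_deg.
by rewrite mdegMn mdeg1 mul1n => nE; apply/eqP; lia.
Qed.
End Shift.

End PolynomialDual.

(** * Quotients *)

Record subclosed (M : stmod) (S : M -> Prop) : Prop := Subclosed {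
  sub0 : S 0;
  subD : forall x y, S x -> S y -> S (x + y);
  sub_pr : forall n x, S x -> S (pr n x);
  sub_Sq : forall i x, S x -> S (Sq i x)
}.

Section Quotient.
Variables (M : stmod) (S : M -> Prop) (hS : subclosed S).

(** The closure proof is an argument so that the predicate itself determines its submodule
    structure. *)
Definition qpred (_ : subclosed S) : {pred M} := fun x => `[< S x >].

Fact qpred_submod : submod_closed (qpred hS).
Proof.
split=> [|a x y /asboolP Sx /asboolP Sy]; apply/asboolP; first exact: sub0 hS.
by rewrite scalef2; case: (a == 0); rewrite ?add0r //; apply: (subD hS).
Qed.

HB.instance Definition _ :=
  GRing.isSubmodClosed.Build 'F_2 M (qpred hS) qpred_submod.

Definition quo : Type := Quotient.quot (qpred hS).

HB.instance Definition _ := EqQuotient.on quo.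
HB.instance Definition _ := GRing.Zmodule.on quo.

Definition proj (x : M) : quo := \pi_quo x.

Lemma proj_eq x y : proj x = proj y <-> S (x - y).
Proof.
have idE : (proj x == proj y) = (x - y \in qpred hS).
  by rewrite /proj Quotient.idealrBE.
by split=> [/eqP|Sxy]; [rewrite idE => /asboolP | apply/eqP; rewrite idE;
  apply/asboolP].
Qed.

Lemma projD : {morph proj : x y / x + y}.
Proof. by move=> x y; rewrite /proj [LHS](Quotient.pi_add (qpred hS)). Qed.

Lemma proj_repr z : proj (repr z) = z.
Proof. exact: reprK. Qed.

Definition quo_scale (a : 'F_2) (z : quo) : quo := proj (a *: repr z).

Lemma proj_scale a z : proj (a *: z) = quo_scale a (proj z).
Proof.
apply/proj_eq; rewrite -scalerBr scalef2; case: ifP => _; first exact: sub0 hS.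
by apply/proj_eq; rewrite proj_repr.
Qed.

Fact quo_scaleA a b z : quo_scale a (quo_scale b z) = quo_scale (a * b) z.
Proof. by rewrite -[z]proj_repr -!proj_scale scalerA. Qed.

Fact quo_scale1 : left_id 1 quo_scale.
Proof. by move=> z; rewrite -[z]proj_repr -proj_scale scale1r. Qed.

Fact quo_scaleDr : right_distributive quo_scale +%R.
Proof.
move=> a x y; rewrite -[x]proj_repr -[y]proj_repr -projD -!proj_scale -projD.
by rewrite scalerDr.
Qed.

Fact quo_scaleDl z : {morph quo_scale^~ z : a b / a + b}.
Proof.
by move=> a b; rewrite -[z]proj_repr -!proj_scale -projD scalerDl.
Qed.

HB.instance Definition _ := GRing.Zmodule_isLmodule.Build 'F_2 quo
  quo_scaleA quo_scale1 quo_scaleDr quo_scaleDl.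

Fact proj_linear : linear proj.
Proof. by move=> a x y; rewrite projD proj_scale. Qed.

HB.instance Definition _ := GRing.isLinear.Build 'F_2 M quo _ proj proj_linear.

Section Induced.
Variables (g : {linear M -> M}) (gS : forall x, S x -> S (g x)).

Definition quo_map_fun (_ : forall x, S x -> S (g x)) (z : quo) : quo :=
  proj (g (repr z)).

Fact quo_map_proj x : quo_map_fun gS (proj x) = proj (g x).
Proof.
by apply/proj_eq; rewrite -linearB; apply/gS/proj_eq; rewrite proj_repr.
Qed.

Fact quo_map_linear : linear (quo_map_fun gS).
Proof.
move=> a x y; rewrite -[x]proj_repr -[y]proj_repr -linearP !quo_map_proj.
by rewrite !linearP.
Qed.

HB.instance Definition _ := GRing.isLinear.Build 'F_2 quo quo _
  (quo_map_fun gS) quo_map_linear.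

Definition quo_map : {linear quo -> quo} := quo_map_fun gS.
End Induced.

Let qpr n := quo_map (@sub_pr _ _ hS n).
Let qSq i := quo_map (@sub_Sq _ _ hS i).

Fact quo_pr_pr m n z : qpr m (qpr n z) = if m == n then qpr n z else 0.
Proof.
rewrite -[z]proj_repr /= !quo_map_proj pr_pr.
by case: ifP; rewrite // linear0.
Qed.

Fact quo_pr_sum z : exists2 t : seq int, uniq t & z = \sum_(n <- t) qpr n z.
Proof.
have [t ut zE] := pr_sum (repr z); exists t => //.
rewrite -[z]proj_repr {1}zE linear_sum; apply: eq_bigr => n _.
by rewrite /= quo_map_proj.
Qed.

Fact quo_Sq_pr i n z : qSq i (qpr n z) = qpr (n - i%:Z) (qSq i z).
Proof. by rewrite -[z]proj_repr /= !quo_map_proj Sq_pr. Qed.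

Fact quo_Sq_0 z : qSq 0 z = z.
Proof. by rewrite -[z]proj_repr /= quo_map_proj Sq_0. Qed.

Fact quo_Adem a b z : (0 < a)%N -> (a < b.*2)%N ->
  qSq b (qSq a z) =
  \sum_(j < a./2.+1) 'C(b - j - 1, a - j.*2)%:R *: qSq j (qSq (a + b - j) z).
Proof.
move=> a0 ab; rewrite -[z]proj_repr /= !quo_map_proj Sq_Adem // linear_sum.
by apply: eq_bigr => j _; rewrite linearZ /= !quo_map_proj.
Qed.

Fact quo_Sq_word w x : Sq_word qSq w (proj x) = proj (Sq_word Sq w x).
Proof. by elim: w x => //= i w IH x; rewrite quo_map_proj IH. Qed.

Fact quo_lfinite z : exists b : seq quo, forall w, exists c : nat -> 'F_2,
  Sq_word qSq w z = \sum_(i < size b) c i *: b`_i.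
Proof.
have [b hb] := lfinite (repr z); exists (map proj b) => w.
have [c hc] := hb w; exists c.
rewrite -[z]proj_repr quo_Sq_word hc linear_sum size_map; apply: eq_bigr => i _.
by rewrite linearZ (nth_map 0).
Qed.

Definition quo_mod : stmod :=
  Stmod quo_pr_pr quo_pr_sum quo_Sq_pr quo_Sq_0 quo_Adem quo_lfinite.

Definition quo_hom : stHom M quo_mod :=
  @StHom M quo_mod proj (fun n x => esym (quo_map_proj (@sub_pr _ _ hS n) x))
    (fun i x => esym (quo_map_proj (@sub_Sq _ _ hS i) x)).

Lemma quo_hom_surj z : exists x, quo_hom x = z.
Proof. by exists (repr z); apply: proj_repr. Qed.

Lemma quo_hom_eq0 x : quo_hom x = 0 <-> S x.
Proof.
by rewrite -[0](linear0 proj) /=; split=> [/proj_eq|Sx]; [|apply/proj_eq];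
  rewrite subr0.
Qed.
End Quotient.

(** * The Mahowald sequences *)

Definition hom0 (M N : stmod) : stHom M N :=
  @StHom M N (\0 : {linear M -> N}) (fun _ _ => esym (linear0 _))
    (fun _ _ => esym (linear0 _)).

Lemma homog_Sq_word (M : stmod) n w (x : M) :
  homog n x -> homog (n - (sumn w)%:Z) (Sq_word Sq w x).
Proof.
elim: w n x => [|i w IH] n x xn /=; first by rewrite subr0.
by rewrite PoszD opprD addrA; apply/IH/homog_Sq.
Qed.

Lemma unstable_Sq (M : stmod) n i (x : M) :
  unstable M -> homog n x -> n < i.*2%:Z -> Sq i x = 0.
Proof. by move=> uM; apply: uM. Qed.

Lemma quo_unstable (M : stmod) (S : M -> Prop) (hS : subclosed S) :
  unstable M -> unstable (quo_mod hS).
Proof.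
move=> uM n i z zn ni; have [x xz] := quo_hom_surj z.
by rewrite -zn -xz -hom_pr -hom_Sq (uM n i) ?linear0 //; apply: pr_homog.
Qed.

Section Generation.
Variables (n : nat) (G : free_unstable n).

(** The quotient of G by the span is unstable, and both the projection and the zero map send the
    generator to 0; by uniqueness they agree, so the quotient is zero. *)
Lemma fu_span (y : G) :
  exists ws : seq (seq nat), y = \sum_(w <- ws) Sq_word Sq w (iota_ G).
Proof.
pose S (y : G) := exists ws : seq (seq nat), y = \sum_(w <- ws) Sq_word Sq w (iota_ G).
have hS : subclosed S.
  split=> [|_ _ [ws ->] [ws' ->]|m _ [ws ->]|i _ [ws ->]].
  - by exists [::]; rewrite big_nil.
  - by exists (ws ++ ws'); rewrite big_cat.
  - exists [seq w <- ws | m == n%:Z - (sumn w)%:Z].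
    rewrite linear_sum big_filter [RHS]big_mkcond; apply: eq_bigr => w _ /=.
    by rewrite -(homog_Sq_word w (iota_homog G)) pr_pr.
  - exists [seq rcons w i | w <- ws]; rewrite linear_sum big_map.
    by apply: eq_bigr => w _; rewrite /Sq_word foldl_rcons.
have uQ := @quo_unstable _ _ hS (fu_unstable G).
have i0 : quo_hom hS (iota_ G) = 0.
  by apply/quo_hom_eq0; exists [:: [::]]; rewrite big_seq1.
have h0 : homog n%:Z (0 : quo_mod hS) by apply: linear0.
have [f _ fE] := fu_univ G uQ h0.
by apply/(quo_hom_eq0 hS); rewrite (fE _ i0) -(fE (hom0 G (quo_mod hS))).
Qed.

Lemma fu_ind (P : G -> Prop) : P (iota_ G) ->
  (forall x y, P x -> P y -> P (x + y)) -> (forall i x, P x -> P (Sq i x)) ->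
  forall y, P y.
Proof.
move=> Pi PD PSq y; have [ws ->] := fu_span y.
(* The case of 0 is reached as iota + iota. *)
elim: ws => [|w ws IH]; first by rewrite big_nil -(addff2 (iota_ G)); apply: PD.
rewrite big_cons; apply: PD => //; move: Pi.
by elim: w (iota_ G) => //= i w IHw x Px; apply/IHw/PSq.
Qed.

(* By the Adem relations, for x in G and Sq_0 x = x Sq^(|x|/2),
   Sq_0 (x Sq^(2i)) = (Sq_0 x) Sq^i and Sq_0 (x Sq^(2i+1)) = 0. *)
Lemma Sq_half (S : G -> Prop) : subclosed S ->
  (forall k : nat, n = k.*2 -> S (Sq k (iota_ G))) ->
  forall k x, S (Sq k (pr k.*2%:Z x)).
Proof.
move=> hS Siota k x; move: x k; apply: fu_ind => [k|x y Sx Sy k|a x Sx k].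
- rewrite -(iota_homog G) pr_pr eqz_nat; case: eqP => [kn|_].
    by rewrite iota_homog; apply: Siota.
  by rewrite linear0; apply: sub0 hS.
- by rewrite !linearD; apply: (subD hS).
set m := (k.*2 + a)%N.
have -> : pr k.*2%:Z (Sq a x) = Sq a (pr m%:Z x) by rewrite Sq_pr PoszD addrK.
have ym : homog m%:Z (pr m%:Z x) by apply: pr_homog.
have Sy j : m = j.*2 -> S (Sq j (pr m%:Z x)) by move=> ->.
move: (pr m%:Z x) ym Sy => y ym Sy.
have [a0|a0] := posnP a; first by rewrite a0 Sq_0; apply: Sy; rewrite /m a0 addn0.
(* For a = 2k the inner operation is Sq_0 on y, since m = 4k; for a > 2k it vanishes by
   instability. *)
have [ak|ka] := ltnP a k.*2; last first.
  have [ak|ak] := eqVneq a k.*2.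
    rewrite ak; apply: (sub_Sq hS); apply: Sy; rewrite /m; lia.
  rewrite (unstable_Sq (fu_unstable G) ym) ?linear0; first exact: sub0 hS.
  by rewrite ltz_nat /m; lia.
rewrite Sq_Adem //; elim/big_ind: _ => [||j _]; [exact: sub0 hS|exact: subD hS|].
rewrite scalef2; case: ifP => _; first exact: sub0 hS.
(* The inner operation has 2(a + k - j) > 2k + a = m unless 2j = a. So only j = a/2 with a even
   survives, and there a + k - j = m/2. *)
apply: (sub_Sq hS); have := ltn_ord j; rewrite ltnS leq_eqVlt => /predU1P[ja|ja].
  have [od|ev] := boolP (odd a).
    rewrite (unstable_Sq (fu_unstable G) ym); first exact: sub0 hS.
    by rewrite ltz_nat /m; lia.
  by apply: Sy; rewrite /m; lia.
rewrite (unstable_Sq (fu_unstable G) ym); first exact: sub0 hS.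
by rewrite ltz_nat /m; lia.
Qed.
End Generation.

Section Mahowald.
Variable G : forall n, free_unstable n.

Notation Sqn n := (Sq_dot G (k := n.+1) (esym (addnn n.+1))).

Lemma Sq_dot_iota k n m (mE : m = (n + k)%N) :
  Sq_dot G mE (iota_ (G n)) = Sq k (iota_ (G m)).
Proof. exact: free_map_iota. Qed.

Lemma p_iota m : p_ G m (iota_ (G m.+1)) = iota_ (G m).
Proof. exact: free_map_iota. Qed.

Lemma p_surj m z : exists y, p_ G m y = z.
Proof.
move: z; apply: fu_ind => [|x y [x' <-] [y' <-]|i x [x' <-]].
- by exists (iota_ (G m.+1)); apply: p_iota.
- by exists (x' + y'); rewrite linearD.
- by exists (Sq i x'); rewrite hom_Sq.
Qed.

Lemma image_subclosed (M N : stmod) (f : stHom M N) :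
  subclosed (fun y => exists x, f x = y).
Proof.
split=> [|_ _ [x <-] [y <-]|n _ [x <-]|i _ [x <-]].
- by exists 0; rewrite linear0.
- by exists (x + y); rewrite linearD.
- by exists (pr n x); rewrite hom_pr.
- by exists (Sq i x); rewrite hom_Sq.
Qed.

Lemma zero_subclosed (M : stmod) : subclosed (fun x : M => x = 0).
Proof. by split=> [|x y -> ->|n x ->|i x ->]; rewrite ?addr0 ?linear0. Qed.

(** Desuspending strengthens the instability condition only by the boundary case 2i = |x|, that is,
    by Sq_0 = 0. *)
Lemma desusp_unstable (M : stmod) : unstable M ->
  (forall k x, Sq k (pr k.*2%:Z x) = 0 :> M) -> unstable (desusp M).
Proof.
move=> uM half m i x xm mi.
have {}xm : @homog M (m + 1) x by move: xm; rewrite /homog /= opprK.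
move: mi; rewrite -lezD1 le_eqVlt => /predU1P[mi|]; last exact: (unstable_Sq uM xm).
by rewrite -xm mi; apply: half.
Qed.

Lemma desusp_homog (M : stmod) (m : nat) (x : M) :
  homog m.+1%:Z x -> @homog (desusp M) m%:Z x.
Proof. by rewrite /homog /= opprK intS addrC. Qed.

(** The generator of G(2n+1) has odd degree, so Sq_0 vanishes on all of G(2n+1). Its desuspension is
    therefore unstable and receives a map from G(2n), which is a left inverse of p. *)
Lemma p_inj_even n : injective (p_ G n.*2).
Proof.
have uD : unstable (desusp (G n.*2.+1)).
  apply: desusp_unstable (fu_unstable _) _.
  by apply: Sq_half (zero_subclosed _) _ => k; lia.
have dn : @homog (desusp (G n.*2.+1)) n.*2%:Z (iota_ (G n.*2.+1)).
  exact/desusp_homog/iota_homog.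
have [h hi _] := fu_univ (G n.*2) uD dn.
apply: (can_inj (g := h)); apply: fu_ind => [|x y hx hy|i x hx].
- by rewrite p_iota hi.
- by rewrite linearD /= linearD /= hx hy.
- by rewrite hom_Sq [LHS]hom_Sq hx.
Qed.

Lemma p_Sqn n y : p_ G n.*2.+1 (Sqn n y) = 0.
Proof.
move: y; apply: fu_ind => [|x y hx hy|i x hx]; last 2 first.
- by rewrite !linearD hx hy addr0.
- by rewrite !hom_Sq hx linear0.
rewrite Sq_dot_iota hom_Sq [X in Sq _ X]p_iota.
by apply: unstable_Sq (fu_unstable _) (iota_homog _) _; rewrite ltz_nat; lia.
Qed.

(** Modulo the image of [Sqn n], Sq_0 kills the generator and hence everything. The desuspended
    quotient is thus unstable, and the projection to the quotient factors through p. *)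
Lemma p_ker n z : p_ G n.*2.+1 z = 0 -> exists y, Sqn n y = z.
Proof.
have hS := image_subclosed (Sqn n).
have uD : unstable (desusp (quo_mod hS)).
  apply: desusp_unstable; first by apply: quo_unstable; apply: fu_unstable.
  move=> k z'; have [x <-] := quo_hom_surj z'.
  rewrite -hom_pr -hom_Sq; apply/quo_hom_eq0; apply: (Sq_half hS) => j jn.
  by exists (iota_ (G n.+1)); rewrite Sq_dot_iota (_ : j = n.+1)%N //; lia.
have dn : @homog (desusp (quo_mod hS)) n.*2.+1%:Z (quo_hom hS (iota_ (G n.+1.*2))).
  exact/desusp_homog/hom_homog/iota_homog.
have [h hi _] := fu_univ (G n.*2.+1) uD dn.
have hp y : h (p_ G n.*2.+1 y) = quo_hom hS y.
  move: y; apply: fu_ind => [|x y hx hy|i x hx].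
  - by rewrite p_iota hi.
  - by rewrite linearD /= linearD /= hx hy linearD.
  - by rewrite hom_Sq [LHS]hom_Sq hx hom_Sq.
move=> pz; apply/(quo_hom_eq0 hS); rewrite -hp pz; exact: linear0.
Qed.
End Mahowald.

(** * Injectivity of Sq^n. by comparison with the dual of J *)

Section Injectivity.
Variable G : forall n, free_unstable n.

Notation Sqn n := (Sq_dot G (k := n.+1) (esym (addnn n.+1))).

Lemma dual_class_map n k N : exists f : stHom (G n) (dual_mod k N),
  f (iota_ (G n)) = dual_iota k N n.
Proof.
by have [f fi _] := fu_univ (G n) (@dual_unstable k N) (dual_iota_homog k N n);
  exists f.
Qed.

Lemma dual_shift_class n k N (f : stHom (G n.+1) (dual_mod k N))
    (g : stHom (G n.+1.*2) (dual_mod k.+1 N)) : (n.+1.*2 < N)%N ->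
  f (iota_ (G n.+1)) = dual_iota k N n.+1 ->
  g (iota_ (G n.+1.*2)) = dual_iota k.+1 N n.+1.*2 ->
  forall y, g (Sqn n y) = dual_shift k N (f y).
Proof.
move=> nN fi gi; apply: fu_ind => [|x y hx hy|i x hx].
- by rewrite Sq_dot_iota hom_Sq gi fi dual_shift_iota.
- by rewrite !linearD hx hy.
- by rewrite !hom_Sq hx.
Qed.

Lemma dual_p_class m k N (f : stHom (G m.+1) (dual_mod k N))
    (g : stHom (G m) (dual_mod k N)) : (m.+1 < N)%N ->
  f (iota_ (G m.+1)) = dual_iota k N m.+1 -> g (iota_ (G m)) = dual_iota k N m ->
  forall y, g (p_ G m y) = dual_p k N (f y).
Proof.
move=> nN fi gi; apply: fu_ind => [|x y hx hy|i x hx].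
- by rewrite p_iota gi fi dual_p_iota.
- by rewrite linearD [LHS]linearD [in RHS]linearD [RHS]linearD hx hy.
- by rewrite hom_Sq [LHS]hom_Sq [in RHS]hom_Sq [RHS]hom_Sq hx.
Qed.

(** Strong induction on n, for all k and N. Undoing Sq^(n/2). halves n and costs one variable, which
    n <= k affords; n < N keeps the class dual to x_0^n from being truncated to 0. *)
Lemma fu_dual_inj n k N (f : stHom (G n) (dual_mod k N)) :
  (n <= k)%N -> (n < N)%N -> f (iota_ (G n)) = dual_iota k N n -> injective f.
Proof.
elim/ltn_ind: n k N f => n IH k N f nk nN fi; apply: raddf_inj => z fz.
case: n => [|m] in IH f nk nN fi z fz *.
  (* G(0) has no other elements, by instability, and its generator maps to a nonzero class. *)
  have: z = 0 \/ z = iota_ (G 0).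
    move: z {fz}; apply: fu_ind => [|x y|i x]; first by right.
      by move=> [->|->] [->|->]; rewrite ?addff2 ?addr0 ?add0r; tauto.
    move=> [->|->]; rewrite ?linear0; first by left.
    have [->|i0] := posnP i; first by rewrite Sq_0; right.
    by left; apply: unstable_Sq (fu_unstable _) (iota_homog _) _;
      rewrite ltz_nat double_gt0.
  by case=> // zi; have := dual_iota_neq0 k nN; rewrite -fi -zi fz eqxx.
(* The map g carries p_m z to [dual_p (f z)], which is 0, so p_m z = 0 by induction. For m even this
   suffices, p_m being injective. *)
have [g gi] := dual_class_map m k N.
have pz0 : p_ G m z = 0.
  apply: (IH m (ltnSn m) k N g (ltnW nk) (ltnW nN) gi).
  by rewrite (dual_p_class nN fi gi) fz !linear0.
have [od|ev] := boolP (odd m); last first.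
  have mE : m = m./2.*2 by have := odd_double_half m; rewrite (negbTE ev).
  have inj : injective (p_ G m) by rewrite mE; apply: p_inj_even.
  by apply: inj; rewrite pz0 linear0.
have [j mE] : exists j, m = j.*2.+1.
  by exists m./2; rewrite -{1}(odd_double_half m) od.
(* For m = 2j + 1, z comes from some y in G(j+1), and f z is the shift of the image of y in the dual
   with one variable fewer. *)
case: k => [|k] in IH f g nk gi fi fz * => //; subst m.
have [y zE] := p_ker pz0; have [h hi] := dual_class_map j.+1 k N.
rewrite -zE; suff -> : y = 0 by rewrite linear0.
apply: (IH j.+1 _ k N h _ _ hi); rewrite ?ltnS; try lia.
apply: (@dual_shift_inj k N); rewrite -(dual_shift_class nN hi fi) zE fz.
by rewrite !linear0.
Qed.

(** Followed by the map to the dual of J, Sq^(n+1). becomes an injective map followed by the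
    injective shift. *)
Lemma Sq_dot_inj n : injective (Sqn n).
Proof.
pose N := n.+1.*2.+1.
have [f fi] := dual_class_map n.+1 n.+1 N.
have [g gi] := dual_class_map n.+1.*2 n.+2 N.
apply: (@inj_compr _ _ _ g); apply: (eq_inj (f := dual_shift n.+1 N \o f)).
  by apply: inj_comp (@dual_shift_inj _ _) _; apply: fu_dual_inj fi => //; rewrite /N;
    lia.
by move=> y; rewrite /= (dual_shift_class _ fi gi).
Qed.

Lemma mahowald_exact n :
  short_exact (desusp_hom (Sqn n)) (desusp_susp_hom (p_ G n.*2.+1)).
Proof.
split; first exact: Sq_dot_inj.
- by move=> y; split=> [/p_ker //|[x <-]]; apply: p_Sqn.
- exact: p_surj.
Qed.

Lemma mahowald_exact2 n :
  short_exact (desusp_hom (desusp_hom (Sqn n)))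
    (desusp_hom (desusp_susp_hom (p_ G n.*2.+1))).
Proof. by have [? ? ?] := mahowald_exact n; split. Qed.
End Injectivity.

(** * Extensions representing Q^r *)

Section LowR.
Variable N : stmod.

Fact R0_respects : respects 0 (fun I (x : N) => if I is [::] then x else 0).
Proof.
split=> [[|//]//|[|i I] x y|[|j J] r I n x _ _|[|j J] r u I x _] //=.
- by rewrite addr0.
- by rewrite big1 // => k _; rewrite scaler0.
- by rewrite big1 // => k _; rewrite scaler0.
Qed.

Lemma Qsym0_inj : injective (@Qsym 0 N [::]).
Proof. by move=> x y /(congr1 (Rlift R0_respects)); rewrite !Rlift_sym. Qed.

Lemma QsymD s I (x y : N) : Qsym s I (x + y) = Qsym s I x + Qsym s I y.
Proof. exact: resp_linear (Qsym_respects s N) I x y. Qed.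

Lemma Qsym_0 s I : Qsym s I (0 : N) = 0.
Proof. by apply: (addIr (Qsym s I (0 : N))); rewrite -QsymD !add0r. Qed.

Lemma R0_homog k (z : Rs 0 N) : Rs_homog k z ->
  exists2 x : N, homog k x & z = Qsym 0 [::] x.
Proof.
case=> t; elim: t z => [|[I x] t IH] z ht ->.
  by exists 0; rewrite ?big_nil ?Qsym_0 // /homog linear0.
have [x' x'k tE] : exists2 x' : N, homog k x' &
    \sum_(u <- t) Qsym 0 u.1 u.2 = Qsym 0 [::] x'.
  by apply: IH => // u ut; apply: ht; rewrite inE ut orbT.
rewrite big_cons tE; have := ht (I, x) (mem_head _ _).
case: I {ht tE} => [|i I] /= xk.
  rewrite /sumz big_nil subr0 in xk.
  by exists (x + x'); rewrite ?QsymD // /homog linearD xk x'k.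
by exists x' => //; rewrite (resp_size (Qsym_respects 0 N)) // add0r.
Qed.

Section Coefficient.
Variables (r n : int) (nr : n <= r).

(* R_1(N) has a basis of elements Q^r x with |x| <= r: this reads off the component of
   degree n of the x in the term Q^r x. *)
Definition R1_sym (I : seq int) (x : N) : N := if I == [:: r] then pr n x else 0.

(** In length 1 the Adem relations are void, and Q^r x = 0 for |x| > r is respected because |x| > r
    >= n leaves no component of degree n. *)
Fact R1_respects (_ : n <= r) : respects 1 R1_sym.
Proof.
have nil2 (J I : seq int) a b : (J ++ a :: b :: I == [:: r]) = false.
  by apply/eqP => /(congr1 size); rewrite size_cat /=; lia.
split=> [I x|I x y|J q I m x xm qm|J q u I x _]; rewrite /R1_sym.
- by case: (I =P _) => // ->.
- by case: ifP => _; rewrite ?linearD ?addr0.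
- case: eqP => // e; case: J I e qm => [|j [|//]] [|i I] //= [-> //]; rewrite /sumz.
  rewrite big_nil addr0 => rm; rewrite -xm pr_pr; case: eqP => // mn.
  by move: rm; rewrite -mn ltNge nr.
- by rewrite nil2 big1 // => k _; rewrite nil2 scaler0.
Qed.

Definition R1_coef : {linear Rs 1 N -> N} := Rlift (R1_respects nr).

Lemma R1_coef_Qsym q x : R1_coef (Qsym 1 [:: q] x) = if q == r then pr n x else 0.
Proof. by rewrite Rlift_sym /R1_sym eqseq_cons andbT. Qed.
End Coefficient.

Lemma d0_Qsym (x : N) B : (forall i, (B <= i)%N -> Sq i x = 0) ->
  d_ 0 N (Qsym 0 [::] (x : desusp N)) = \sum_(i < B) Qsym 1 [:: i%:Z - 1] (Sq i x).
Proof. by move=> hB; rewrite d_Qsym (d_symE 0 [::] hB). Qed.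

Lemma R1_coef_d0 (i : nat) (n : int) (ni : n <= i%:Z - 1) (x : N) :
  R1_coef ni (d_ 0 N (Qsym 0 [::] (x : desusp N))) = pr n (Sq i x).
Proof.
have [B hB] := Sq_finite x.
rewrite (@d0_Qsym x (maxn B i.+1)); last first.
  by move=> j hj; apply: hB; apply: leq_trans hj; apply: leq_maxl.
have iB : (i < maxn B i.+1)%N by apply: leq_maxr.
rewrite linear_sum (bigD1 (Ordinal iB)) // R1_coef_Qsym eqxx big1 => [|j ji];
  first exact: addr0.
rewrite R1_coef_Qsym; case: eqP => // /addIr [ij].
by move: ji; rewrite -val_eqE /= ij eqxx.
Qed.
End LowR.

Lemma Rmap_Qsym s (M N : stmod) (f : stHom M N) I x :
  Rmap s f (Qsym s I x) = Qsym s I (f x).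
Proof. exact: Rlift_sym. Qed.

Lemma Qop_Qsym s (N : stmod) r I (x : N) :
  Qop s N r (Qsym s I x) = Qsym s.+1 (r :: I) x.
Proof. exact: Rlift_sym. Qed.

Lemma d0_natural (M N : stmod) (f : stHom M N) (x : M) :
  d_ 0 N (Qsym 0 [::] (f x : desusp N)) =
  Rmap 1 f (d_ 0 M (Qsym 0 [::] (x : desusp M))).
Proof.
have [B hB] := Sq_finite x.
rewrite (d0_Qsym hB) (@d0_Qsym _ _ B); last first.
  by move=> i hi; rewrite -hom_Sq hB // linear0.
by rewrite linear_sum; apply: eq_bigr => i _; rewrite /= Rmap_Qsym hom_Sq.
Qed.

(** The cycle z of the extension agrees with Q^r iota_n only up to a boundary d y; correcting the
    lift of iota_m by y gives d e = Q^r iota_n on the nose. Comparing coefficients in R_1 then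
    determines e.Sq^i. *)
Lemma is_Q_ext_lift (G : forall n, free_unstable n) n r m
    (Q : extension (desusp (G n)) (G m)) : is_Q_ext r Q ->
  exists e : Q, [/\ homog m%:Z e, ext_out Q e = iota_ (G m) &
    forall i : nat, (m < i.*2)%N ->
      Sq i e = if i == r.+1 then ext_in Q (iota_ (G n)) else 0].
Proof.
case=> mE [z [_ [e0 [e0h e0out e0d]]] [_ _ [y yh yE]]].
have [x xh e0E] := R0_homog e0h; have [y' y'h y'E] := R0_homog yh.
rewrite e0E Rmap_Qsym in e0out; have xout := Qsym0_inj e0out.
(* Here y' lies in the double desuspension of G(n); regarded in the sub of Q it has degree m, like
   x. *)
pose e : Q := (x : Q) + ext_in Q y'.
have em : homog m%:Z e.
  have xm : @homog Q m%:Z x by move: xh; rewrite /homog /= opprK subrK.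
  have ym : @homog (desusp (G n)) m%:Z y'.
    by move: y'h; rewrite /homog /= !opprK subrK.
  by rewrite /homog linearD xm (hom_homog _ ym).
have eout : ext_out Q e = iota_ (G m).
  have [_ exQ _] := ext_exact Q.
  have -> : ext_out Q e = ext_out Q x + ext_out Q (ext_in Q y') by apply: linearD.
  rewrite (_ : ext_out Q (ext_in Q y') = 0) ?addr0 //.
  by apply/exQ; exists y'.
have ed : d_ 0 Q (Qsym 0 [::] (e : desusp Q)) =
    Qsym 1 [:: r%:Z] (ext_in Q (iota_ (G n))).
  have -> : d_ 0 Q (Qsym 0 [::] (e : desusp Q)) =
      d_ 0 Q (Qsym 0 [::] x) + d_ 0 Q (Qsym 0 [::] (ext_in Q y' : desusp Q)).
    by rewrite -linearD; congr (d_ 0 Q _); apply: (@QsymD (desusp Q)).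
  (* The summand x contributes z and y' contributes z - Q^r iota_n; over F_2 the two copies of z
     cancel. *)
  rewrite -e0E e0d d0_natural -y'E -yE -linearD.
  rewrite [- Qop _ _ _ _]oppf2 addrA addff2 add0r.
  by rewrite /hom_class Qop_Qsym Rmap_Qsym.
exists e; split=> // i mi.
(* The element e.Sq^i of degree m - i can be read off the term Q^(i-1) (e.Sq^i) of d e, as its
   degree is at most i - 1. *)
have ni : m%:Z - i%:Z <= i%:Z - 1 by lia.
have := congr1 (R1_coef Q ni) ed.
rewrite R1_coef_d0 R1_coef_Qsym (homog_Sq i em) => ->.
have -> : (r%:Z == i%:Z - 1) = (i == r.+1) by rewrite eq_sym subr_eq addrC -intS eqz_nat.
case: eqP => // ir; apply: hom_homog.
rewrite /homog /= (_ : _ - - 1 = n%:Z); first exact: iota_homog.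
by rewrite ir; lia.
Qed.

(** * Diagram chases: factorization, the five lemma and pushouts *)

Definition surj (A B : Type) (f : A -> B) : Prop := forall y, exists x, f x = y.

Lemma inj_surj_bij (A B : Type) (f : A -> B) : injective f -> surj f -> bijective f.
Proof.
move=> f_inj f_surj; exists (fun y => projT1 (cid (f_surj y))) => x.
  by apply: f_inj; case: cid.
by case: cid.
Qed.

Section HomFactor.
Variables (A B X : stmod) (b : stHom A B) (u : stHom A X).
Hypotheses (b_surj : surj b) (ker_b : forall y, b y = 0 -> u y = 0).

Let lift z := projT1 (cid (b_surj z)).
Let liftK z : b (lift z) = z. Proof. exact: projT2 (cid (b_surj z)). Qed.

Definition factor (_ : surj b) (_ : forall y, b y = 0 -> u y = 0) (z : B) : X :=
  u (lift z).

Fact factorE y : factor b_surj ker_b (b y) = u y.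
Proof.
apply/eqP; rewrite -subr_eq0 -linearB; apply/eqP/ker_b.
by rewrite linearB liftK subrr.
Qed.

Fact factor_linear : linear (factor b_surj ker_b).
Proof.
by move=> a y z; rewrite -[y]liftK -[z]liftK -linearP !factorE linearP.
Qed.

HB.instance Definition _ :=
  GRing.isLinear.Build 'F_2 B X _ (factor b_surj ker_b) factor_linear.

Fact factor_pr n z : factor b_surj ker_b (pr n z) = pr n (factor b_surj ker_b z).
Proof. by rewrite -[z]liftK -hom_pr !factorE hom_pr. Qed.

Fact factor_Sq i z : factor b_surj ker_b (Sq i z) = Sq i (factor b_surj ker_b z).
Proof. by rewrite -[z]liftK -hom_Sq !factorE hom_Sq. Qed.

Lemma hom_factor : exists w : stHom B X, forall y, w (b y) = u y.
Proof.
by exists (@StHom B X (factor b_surj ker_b) factor_pr factor_Sq); apply: factorE.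
Qed.
End HomFactor.

Section FiveLemma.
Variables (A B C A' B' C' : stmod).
Variables (f : stHom A B) (g : stHom B C) (f' : stHom A' B') (g' : stHom B' C').
Variables (a : stHom A A') (b : stHom B B') (c : stHom C C').
Hypotheses (fg : short_exact f g) (fg' : short_exact f' g').
Hypotheses (bf : forall x, b (f x) = f' (a x)) (cg : forall y, c (g y) = g' (b y)).

Lemma five_inj : injective a -> injective c -> injective b.
Proof.
have [_ kerg _] := fg; have [f'_inj _ _] := fg'.
move=> a_inj c_inj; apply: raddf_inj => y by0.
have gy0 : g y = 0 by apply: c_inj; rewrite cg by0 !linear0.
have /kerg[x xy] := gy0; rewrite -xy; suff -> : x = 0 by rewrite linear0.
by apply: a_inj; apply: f'_inj; rewrite -bf xy by0 !linear0.
Qed.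

Lemma five_surj : surj a -> surj c -> surj b.
Proof.
have [_ _ g_surj] := fg; have [_ kerg' _] := fg'.
move=> a_surj c_surj z; have [w wz] := c_surj (g' z); have [y yw] := g_surj w.
have /kerg'[x xz] : g' (z - b y) = 0 by rewrite linearB -cg yw wz subrr.
have [x' x'x] := a_surj x; exists (f x' + y).
by rewrite linearD bf x'x xz subrK.
Qed.
End FiveLemma.

Section Pushout.
Variables (A B C A' B' C' : stmod).
Variables (f : stHom A B) (g : stHom B C) (f' : stHom A' B') (g' : stHom B' C').
Variables (a : stHom A A') (b : stHom B B') (c : stHom C C').
Hypotheses (fg : short_exact f g) (fg' : short_exact f' g').
Hypotheses (bf : forall x, b (f x) = f' (a x)) (cg : forall y, c (g y) = g' (b y)).

(** By diagram chase b is surjective, with kernel contained in f(ker a). A compatible u kills that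
    kernel, so it factors uniquely through b. *)
Lemma pushout_of_surj : surj a -> injective c -> surj c -> is_pushout f a b f'.
Proof.
move=> a_surj c_inj c_surj; split=> // X u v uv.
have b_surj := five_surj fg fg' bf cg a_surj c_surj.
have [_ kerg _] := fg; have [f'_inj _ _] := fg'.
have ker_b y : b y = 0 -> u y = 0.
  move=> by0; have /kerg[x xy] : g y = 0 by apply: c_inj; rewrite cg by0 !linear0.
  have ax0 : a x = 0 by apply: f'_inj; rewrite -bf xy by0 linear0.
  by rewrite -xy uv ax0 linear0.
have [w wE] := hom_factor b_surj ker_b; exists w; split=> //.
  by move=> y; have [x <-] := a_surj y; rewrite -bf wE uv.
by move=> w' w'u _ z; have [y <-] := b_surj z; rewrite w'u wE.
Qed.
End Pushout.

(** * Unstable suspensions of Q(n, r) *)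

Section Excess.
Variables (d : nat) (M : stmod).

(* The submodule of M whose d-fold suspension is the largest unstable submodule of
   the d-fold suspension of M. *)
Definition excess_bounded (x : M) : Prop :=
  forall (k : int) (i : nat), k + d%:Z < i.*2%:Z -> Sq i (pr k x) = 0.

Lemma excess_boundedD x y :
  excess_bounded x -> excess_bounded y -> excess_bounded (x + y).
Proof. by move=> hx hy k i ki; rewrite !linearD hx ?hy ?addr0. Qed.

(** Let y have degree k + a, with k + d < 2b. If a >= 2b, then y.Sq^a is already 0. Otherwise the
    Adem terms begin with Sq^(a+b-j), where 2(a + b - j) >= a + 2b > (k + a) + d, so each vanishes
    on y. *)
Lemma excess_bounded_Sq a x : excess_bounded x -> excess_bounded (Sq a x).
Proof.
move=> hx k b kb; have -> : pr k (Sq a x) = Sq a (pr (k + a%:Z) x).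
  by rewrite Sq_pr addrK.
have [->|a0] := posnP a; first by rewrite Sq_0 addr0 hx.
have [ab|ba] := ltnP a b.*2; last by rewrite [Sq a _]hx ?linear0 //; lia.
rewrite Sq_Adem // big1 // => j _; rewrite [Sq (a + b - j) _]hx ?linear0 ?scaler0 //.
by have := ltn_ord j; lia.
Qed.
End Excess.

(** The class e and the sub generate Q. The sub satisfies the bound already for d = 1, since its
    first suspension G(n) is unstable. *)
Lemma ext_excess_bounded (G : forall n, free_unstable n) d n m
    (Q : extension (desusp (G n)) (G m)) (e : Q) : (0 < d)%N ->
  homog m%:Z e -> ext_out Q e = iota_ (G m) ->
  (forall i, (m + d < i.*2)%N -> Sq i e = 0) ->
  forall x : Q, excess_bounded d x.
Proof.
move=> d0 em eout hSq x.
have he : excess_bounded d e.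
  move=> k i ki; rewrite -em pr_pr; case: eqP => [km|_]; last by rewrite linear0.
  by rewrite em hSq //; lia.
have [x' [x'x hx']] : exists x', ext_out Q x' = ext_out Q x /\ excess_bounded d x'.
  move: (ext_out Q x); apply: fu_ind => [|_ _ [y [<- hy]] [z [<- hz]]|i _ [y [<- hy]]].
  - by exists e.
  - by exists (y + z); split; [rewrite linearD | apply: excess_boundedD].
  - by exists (Sq i y); split; [rewrite hom_Sq | apply: excess_bounded_Sq].
have [_ exQ _] := ext_exact Q.
have /exQ[y yE] : ext_out Q (x - x') = 0 by rewrite linearB x'x subrr.
rewrite -[x](subrK x') -yE; apply: excess_boundedD => // k i ki.
rewrite -hom_pr -hom_Sq.
have -> : Sq i (pr k y) = 0; last by rewrite linear0.
by apply: (unstable_Sq (fu_unstable (G n)) (pr_homog _ _)); lia.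
Qed.

(** * Comparison of Q(n, r) with the Mahowald sequences *)

Section Comparison.
Variable G : forall n, free_unstable n.

Notation Sqn n := (Sq_dot G (k := n.+1) (esym (addnn n.+1))).

Lemma p_desusp_surj m : surj (desusp_susp_hom (p_ G m)).
Proof. exact: p_surj. Qed.

(** Here |e| = 2n + 1, and the exceptional operation Sq^(n+1) has 2(n + 1) = |e| + 1, so one
    suspension of Q is unstable. The map F from G(2n+2) classifying e matches iota.Sq^(n+1) with
    e.Sq^(n+1), the image of iota_{n+1}. *)
Lemma Q_ext_iso_mahowald n (Q : extension (desusp (G n.+1)) (G n.*2.+1)) :
  is_Q_ext n Q -> ext_iso (Extension (mahowald_exact G n)) Q.
Proof.
move=> /is_Q_ext_lift[e [em eout eSq]].
have bd : forall x : Q, excess_bounded 1 x.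
  by apply: (ext_excess_bounded _ em eout) => // i mi; rewrite eSq ?gtn_eqF //; lia.
have uQ : unstable (susp 1 Q).
  by move=> k i x xk ki; rewrite -xk; apply: bd; rewrite subrK.
have eh : @homog (susp 1 Q) n.+1.*2%:Z e.
  by rewrite /homog /= (_ : _ - 1 = n.*2.+1%:Z) //; lia.
have [F Fe _] := fu_univ (G n.+1.*2) uQ eh.
have t_in x : F (Sqn n x) = ext_in Q x.
  move: x; apply: fu_ind => [|x y hx hy|i x hx].
  - by rewrite Sq_dot_iota hom_Sq Fe [LHS]eSq ?eqxx //; lia.
  - by rewrite linearD [LHS]linearD hx hy [RHS]linearD.
  - by rewrite hom_Sq [LHS]hom_Sq hx [RHS]hom_Sq.
have t_out y : ext_out Q (F y) = p_ G n.*2.+1 y.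
  move: y; apply: fu_ind => [|x y hx hy|i x hx].
  - by rewrite Fe p_iota.
  - by rewrite linearD [LHS]linearD hx hy [RHS]linearD.
  - by rewrite hom_Sq [LHS]hom_Sq hx [RHS]hom_Sq.
have ex := mahowald_exact G n; have exQ := ext_exact Q.
have sq1 x : desusp_susp_hom F (desusp_hom (Sqn n) x) = ext_in Q (hom_id _ x) by apply: t_in.
have sq2 y : hom_id _ (desusp_susp_hom (p_ G n.*2.+1) y) = ext_out Q (desusp_susp_hom F y).
  by rewrite /= t_out.
exists (desusp_susp_hom F); split=> //=.
apply: inj_surj_bij.
  by apply: (five_inj ex exQ sq1 sq2) => x y.
by apply: (five_surj ex exQ sq1 sq2) => y; exists y.
Qed.

(** Here |e| = 2n and 2(n + 1) = |e| + 2, so two suspensions are needed. The map p_n enters because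
    iota_{2n+2}.Sq^(n+1) goes to e.Sq^(n+1), the image of iota_n = p_n(iota_{n+1}). *)
Lemma Q_ext_pushout_mahowald n (Q : extension (desusp (G n)) (G n.*2)) :
  is_Q_ext n Q -> exists b : stHom (desusp (desusp (G n.+1.*2))) Q,
    (forall x, b (desusp_hom (desusp_hom (Sqn n)) x) =
       ext_in Q (desusp_hom (desusp_susp_hom (p_ G n)) x)) /\
    (forall y, desusp_susp_hom (p_ G n.*2)
         (desusp_hom (desusp_susp_hom (p_ G n.*2.+1)) y) = ext_out Q (b y)).
Proof.
move=> /is_Q_ext_lift[e [em eout eSq]].
have bd : forall x : Q, excess_bounded 2 x.
  by apply: (ext_excess_bounded _ em eout) => // i mi; rewrite eSq ?gtn_eqF //; lia.
have uQ : unstable (susp 1 (susp 1 Q)).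
  by move=> k i x xk ki; rewrite -xk; apply: bd; move: ki; lia.
have eh : @homog (susp 1 (susp 1 Q)) n.+1.*2%:Z e.
  by rewrite /homog /= (_ : _ - 1 - 1 = n.*2%:Z) //; lia.
have [F Fe _] := fu_univ (G n.+1.*2) uQ eh.
exists (desusp_susp_hom (desusp_susp_hom F)); split=> /=.
  apply: fu_ind => [|x y hx hy|i x hx].
  - by rewrite Sq_dot_iota hom_Sq Fe p_iota [LHS]eSq ?eqxx //; lia.
  - by rewrite linearD [LHS]linearD [in RHS]linearD [RHS]linearD hx hy.
  - rewrite hom_Sq [LHS]hom_Sq hx; apply: etrans (esym (hom_Sq (ext_in Q) i _)) _.
    exact: congr1 (esym (hom_Sq (p_ G n) i x)).
apply: fu_ind => [|x y hx hy|i x hx].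
- by rewrite Fe [X in p_ G _ X]p_iota p_iota.
- by rewrite linearD [LHS]linearD [in RHS]linearD [RHS]linearD hx hy.
- apply: etrans (congr1 (p_ G n.*2) (hom_Sq (p_ G n.*2.+1) i x)) _.
  rewrite [LHS]hom_Sq [in RHS]hom_Sq; apply: etrans (esym (hom_Sq (ext_out Q) i _)).
  exact: congr1 hx.
Qed.
End Comparison.

(* In both parts the Mahowald sequence is the one of index n.+1,
   G(n+1) -> G(2n+2) -> \Sigma G(2n+1), so that n.+1 >= 1 is the n of (a). *)
Theorem proposition1p6 (G : forall n : nat, free_unstable n) :
  (forall n : nat,
     exists ex : short_exact
       (desusp_hom (Sq_dot G (k := n.+1) (esym (addnn n.+1))))
       (desusp_susp_hom (p_ G n.*2.+1)),
     forall Q : extension (desusp (G n.+1)) (G n.*2.+1),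
       is_Q_ext n Q -> ext_iso (Extension ex) Q)
  /\
  (forall n : nat,
     let top_in :=
       desusp_hom (desusp_hom (Sq_dot G (k := n.+1) (esym (addnn n.+1)))) in
     let top_out := desusp_hom (desusp_susp_hom (p_ G n.*2.+1)) in
     short_exact top_in top_out /\
     forall Q : extension (desusp (G n)) (G n.*2),
       is_Q_ext n Q ->
       (exists (b : stHom (desusp (desusp (G n.+1.*2))) Q)
               (c : stHom (desusp (G n.*2.+1)) (G n.*2)),
          [/\ is_pushout top_in (desusp_hom (desusp_susp_hom (p_ G n)))
                b (ext_in Q),
              forall y, c (top_out y) = ext_out Q (b y)
            & bijective c]) /\
       (~~ odd n -> seq_iso top_in top_out (ext_in Q) (ext_out Q))).
Proof.
split=> n; first by exists (mahowald_exact G n) => Q; apply: Q_ext_iso_mahowald.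
move=> top_in top_out; split=> [|Q QP]; first exact: mahowald_exact2.
have [b [b_in b_out]] := Q_ext_pushout_mahowald QP.
have ex := mahowald_exact2 G n; have exQ := ext_exact Q.
pose a := desusp_hom (desusp_susp_hom (p_ G n)).
pose c := desusp_susp_hom (p_ G n.*2).
have a_surj : surj a by apply: p_desusp_surj.
have c_surj : surj c by apply: p_desusp_surj.
have c_inj : injective c by apply: p_inj_even.
have c_bij := inj_surj_bij c_inj c_surj.
split.
  exists b, c; split=> //.
  exact: (pushout_of_surj ex exQ b_in b_out a_surj c_inj c_surj).
(* For n even p_n is an isomorphism as well, so the five lemma applies to b. *)
move=> even_n; have a_inj : injective a.
  have nE : n = n./2.*2 by have := odd_double_half n; rewrite (negbTE even_n).
  have : injective (p_ G n) by rewrite nE; apply: p_inj_even.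
  by [].
exists a, b, c; split=> //; apply: inj_surj_bij => //.
  exact: (five_inj ex exQ b_in b_out a_inj c_inj).
exact: (five_surj ex exQ b_in b_out a_surj c_surj).
Qed.
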